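(* Let $(M,F)$ be a complex Finsler space with $(\alpha,\beta)$-metric. Suppose that $\frac{\partial|\beta|^2}{\partial z^i}=||b||^2\frac{\partial\alpha^2}{\partial z^i}$ for all $i$, and that one of the following conditions (which are equivalent under this assumption) holds for all values of the free indices: i) $||b||^2b^r\frac{\partial a_{r\bar m}}{\partial z^l}\bar\eta^m=\bar\beta\,\bar b^mb^r\frac{\partial a_{r\bar m}}{\partial z^l}$; ii) $||b||^2\frac{\partial b_{\bar m}}{\partial z^i}\bar\eta^m=\bar\beta\,\frac{\partial b_{\bar m}}{\partial z^i}\bar b^m$; iii) $b_{\bar s}\frac{\partial b_{\bar m}}{\partial z^i}\bar\eta^m=\bar\beta\,\frac{\partial b_{\bar s}}{\partial z^i}$; iv) $\bar\beta\Big(\frac{\partial b_i}{\partial z^l}\eta^i\eta^l-2b_l\overset{a}{G}{}^l\Big)+\beta\frac{\partial b_{\bar m}}{\partial z^l}\bar\eta^m\eta^l=0$. Then the space $(M,F)$ is generalized Berwald. Moreover, if $\alpha$ is Kähler, then $(M,F)$ is a complex Berwald space.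
   Context: Let $M$ be a complex manifold of dimension $n$, $T'M$ its holomorphic tangent bundle with local coordinates $(z^k,\eta^k)$. Let $a_{i\bar j}(z)dz^i\otimes d\bar z^j$ be a Hermitian metric on $M$ (a purely Hermitian metric) with inverse matrix $(a^{\bar ji})$ and $b=b_i(z)dz^i$ a differential $(1,0)$-form; set $\alpha(z,\eta)=\sqrt{a_{i\bar j}(z)\eta^i\bar\eta^j}$, $\beta(z,\eta)=b_i(z)\eta^i$, $b_{\bar j}=\overline{b_j}$, $b^i=a^{\bar ji}b_{\bar j}$, $\bar b^i=\overline{b^i}$, $||b||^2=a^{\bar ji}b_ib_{\bar j}$. A complex $(\alpha,\beta)$-metric is a complex Finsler metric of the form $F(z,\eta)=F(\alpha(z,\eta),|\beta(z,\eta)|)$, i.e. with $L:=F^2$: $F$ continuous, $F\ge0$ with equality iff $\eta=0$, $F(z,\lambda\eta)=|\lambda|F(z,\eta)$ for $\lambda\in\mathbb C$, $L$ smooth and $g_{i\bar j}:=\partial^2L/\partial\eta^i\partial\bar\eta^j$ positive definite for $\eta\neq0$; where $|\beta|$ causes non-smoothness or singularity at $\beta=0$, these conditions and all differential identities are understood where $\beta\neq0$. Notation: $(g^{\bar ji})$ is the inverse matrix of $(g_{i\bar j})$; $\dot\partial_k=\partial/\partial\eta^k$; summation convention. For $F$: $N^i_j:=g^{\bar mi}\frac{\partial g_{l\bar m}}{\partial z^j}\eta^l$, $L^i_{jk}:=\dot\partial_jN^i_k$, $G^i:=\tfrac12N^i_j\eta^j$, $\overset{B}{L}{}^i_{jk}:=\dot\partial_k\dot\partial_jG^i$.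 For $\alpha$: $\overset{a}{N}{}^k_j:=a^{\bar mk}\frac{\partial a_{l\bar m}}{\partial z^j}\eta^l$, $\overset{a}{G}{}^l:=\tfrac12\overset{a}{N}{}^l_j\eta^j$; $\alpha$ is Kähler if the Hermitian metric $a$ is Kähler, i.e. $\frac{\partial a_{i\bar j}}{\partial z^k}=\frac{\partial a_{k\bar j}}{\partial z^i}$. $(M,F)$ is Kähler if $(L^i_{jk}-L^i_{kj})\eta^j=0$; complex Berwald if it is Kähler and the $L^i_{jk}$ depend only on $z$; generalized Berwald if the $\overset{B}{L}{}^i_{jk}$ depend only on $z$. *)

(* Defs.v *)
From HB Require Import structures.
From mathcomp Require Import all_boot all_order all_algebra.
From mathcomp Require Import complex.
From mathcomp Require Import all_classical all_reals all_analysis.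

Set Implicit Arguments.
Unset Strict Implicit.
Unset Printing Implicit Defensive.

Import Order.TTheory GRing.Theory Num.Theory numFieldNormedType.Exports.

Local Open Scope classical_set_scope.
Local Open Scope ring_scope.

(* R[i] packed as a numClosedFieldType: the topology and norm of
   numFieldNormedType are found on this sort but not on R[i] itself. *)
Definition cplx (R : realType) : numClosedFieldType := R[i].

Section Calculus.
Variable R : realType.

Definition re (w : cplx R) : R := complex.Re w.
Definition im (w : cplx R) : R := complex.Im w.
Definition real_cplx (x : R) : cplx R := Complex x 0.
Definition iunit : cplx R := Complex 0 1.

Section RealDirections.
Variable E : normedModType (cplx R).

(* E is regarded as a real vector space: only real multiples of the direction
   v are used. *)
Definition real_line (x v : E) (t : R) : E := x + real_cplx t *: v.

Definition rder (v : E) (f : E -> R) (x : E) : R :=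
  derive1 (fun t : R => f (real_line x v t)) 0.

(* C^oo in the real sense on an open set A: all iterated directional
   derivatives exist and are continuous on A. *)
Definition smooth_on (A : set E) (f : E -> R) : Prop :=
  forall (vs : seq E) (x : E), A x ->
    {for x, continuous (foldr rder f vs)} /\
    forall v : E,
      derivable (fun t : R => foldr rder f vs (real_line x v t)) 0 1.

Definition csmooth_on (A : set E) (f : E -> cplx R) : Prop :=
  smooth_on A (re \o f) /\ smooth_on A (im \o f).

Definition cder (v : E) (f : E -> cplx R) (x : E) : cplx R :=
  Complex (rder v (re \o f) x) (rder v (im \o f) x).

End RealDirections.

Variable n : nat.

(* Wirtinger derivatives: for z^k = x^k + i y^k,
   d/dz^k = (d/dx^k - i d/dy^k)/2 and d/dzbar^k = (d/dx^k + i d/dy^k)/2. *)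
Definition dhol (k : 'I_n) (f : 'rV[cplx R]_n -> cplx R) (z : 'rV[cplx R]_n) : cplx R :=
  2^-1 * (cder (delta_mx 0 k) f z - iunit * cder (iunit *: delta_mx 0 k) f z).

Definition dbar (k : 'I_n) (f : 'rV[cplx R]_n -> cplx R) (z : 'rV[cplx R]_n) : cplx R :=
  2^-1 * (cder (delta_mx 0 k) f z + iunit * cder (iunit *: delta_mx 0 k) f z).

End Calculus.

(* The atlas is an arbitrary holomorphic atlas, not necessarily maximal. *)
Record complex_manifold (R : realType) (n : nat) := ComplexManifold {
  mcarrier :> topologicalType ;
  chart_index : Type ;
  chart_dom : chart_index -> set mcarrier ;
  chart : chart_index -> mcarrier -> 'rV[cplx R]_n ;
  chart_inv : chart_index -> 'rV[cplx R]_n -> mcarrier ;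
  _ : hausdorff_space mcarrier ;
  _ : @second_countable mcarrier ;
  _ : forall p : mcarrier, exists c, chart_dom c p ;
  _ : forall c, open (chart_dom c) ;
  _ : forall c, open (chart c @` chart_dom c) ;
  _ : forall c p, chart_dom c p -> chart_inv c (chart c p) = p ;
  _ : forall c, {within chart_dom c, continuous (chart c)} ;
  _ : forall c, {within chart c @` chart_dom c, continuous (chart_inv c)} ;
  _ : forall c d z, (chart c @` (chart_dom c `&` chart_dom d)) z ->
        differentiable (chart d \o chart_inv c) z
}.

Section Manifold.
Variables (R : realType) (n : nat) (M : complex_manifold R n).

Definition chart_img (c : chart_index M) : set 'rV[cplx R]_n := chart c @` chart_dom c.

Definition overlap (c d : chart_index M) : set 'rV[cplx R]_n :=
  chart c @` (chart_dom c `&` chart_dom d).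

Definition transition (c d : chart_index M) : 'rV[cplx R]_n -> 'rV[cplx R]_n :=
  chart d \o chart_inv c.

(* Row i, column k is d(z')^k / dz^i, so that tangent vectors transform by
   eta' = eta *m trans_jac. *)
Definition trans_jac (c d : chart_index M) (z : 'rV[cplx R]_n) : 'M[cplx R]_n :=
  'J (transition c d) z.

(* A tensor field is the family of its coefficients in the charts. *)
Definition metric_coef := chart_index M -> 'rV[cplx R]_n -> 'M[cplx R]_n.
Definition form_coef := chart_index M -> 'rV[cplx R]_n -> 'rV[cplx R]_n.
(* A function on T'M, in the induced coordinates (z, eta). *)
Definition tangent_fun :=
  chart_index M -> 'rV[cplx R]_n -> 'rV[cplx R]_n -> R.

End Manifold.

Definition pos_def (R : realType) (n : nat) (h : 'M[cplx R]_n) : Prop :=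
  forall xi : 'rV[cplx R]_n, xi != 0 ->
    0 < \sum_(i < n) \sum_(j < n) h i j * xi 0 i * (xi 0 j)^*.

Definition hermitian_metric (R : realType) (n : nat) (M : complex_manifold R n)
    (a : metric_coef M) : Prop :=
  [/\ forall c i j, csmooth_on (chart_img c) (fun z => a c z i j),
      forall c z i j, chart_img c z -> a c z i j = (a c z j i)^*,
      forall c z, chart_img c z -> pos_def (a c z) &
      forall c d z i j, overlap c d z ->
        a c z i j = \sum_(k < n) \sum_(l < n)
          trans_jac c d z i k * (trans_jac c d z j l)^*
            * a d (transition c d z) k l].

Definition form10 (R : realType) (n : nat) (M : complex_manifold R n)
    (b : form_coef M) : Prop :=
  (forall c i, csmooth_on (chart_img c) (fun z => b c z 0 i)) /\
  (forall c d z i, overlap c d z ->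
     b c z 0 i = \sum_(k < n) trans_jac c d z i k * b d (transition c d z) 0 k).

(* In the coordinates of one chart. A matrix h stands for (h_{i jbar}); its
   inverse (h^{jbar i}), with h^{jbar i} h_{k jbar} = delta^i_k, is
   invmx h j i. *)
Section Local.
Variables (R : realType) (n : nat).
Implicit Types (z eta : 'rV[cplx R]_n) (i j k l : 'I_n).

Section AlphaBeta.
Variables (a : 'rV[cplx R]_n -> 'M[cplx R]_n).
Variables (b : 'rV[cplx R]_n -> 'rV[cplx R]_n).

Definition alpha z eta : R :=
  Num.sqrt (re (\sum_(i < n) \sum_(j < n)
                  a z i j * eta 0 i * (eta 0 j)^*)).

Definition beta z eta : cplx R := \sum_(i < n) b z 0 i * eta 0 i.

Definition abs_beta z eta : R := re `|beta z eta|.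

Definition bbar_low j z : cplx R := (b z 0 j)^*.

Definition b_up i z : cplx R := \sum_(j < n) invmx (a z) j i * bbar_low j z.

Definition bbar_up i z : cplx R := (b_up i z)^*.

Definition norm_b2 z : cplx R :=
  \sum_(i < n) \sum_(j < n) invmx (a z) j i * b z 0 i * bbar_low j z.

Definition Na k j z eta : cplx R :=
  \sum_(m < n) \sum_(l < n)
    invmx (a z) m k * dhol j (fun w => a w l m) z * eta 0 l.

Definition Ga l z eta : cplx R := 2^-1 * \sum_(j < n) Na l j z eta * eta 0 j.

Definition beta_alpha_proportional z eta : Prop :=
  forall i, dhol i (fun w => real_cplx (abs_beta w eta ^+ 2)) z =
    norm_b2 z * dhol i (fun w => real_cplx (alpha w eta ^+ 2)) z.

Definition cond_i z eta : Prop :=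
  forall l,
    norm_b2 z * (\sum_(r < n) \sum_(m < n)
       b_up r z * dhol l (fun w => a w r m) z * (eta 0 m)^*) =
    (beta z eta)^* * (\sum_(m < n) \sum_(r < n)
       bbar_up m z * b_up r z * dhol l (fun w => a w r m) z).

Definition cond_ii z eta : Prop :=
  forall i,
    norm_b2 z * (\sum_(m < n) dhol i (bbar_low m) z * (eta 0 m)^*) =
    (beta z eta)^* * (\sum_(m < n) dhol i (bbar_low m) z * bbar_up m z).

Definition cond_iii z eta : Prop :=
  forall s i,
    bbar_low s z * (\sum_(m < n) dhol i (bbar_low m) z * (eta 0 m)^*) =
    (beta z eta)^* * dhol i (bbar_low s) z.

Definition cond_iv z eta : Prop :=
  (beta z eta)^* *
    ((\sum_(i < n) \sum_(l < n)
        dhol l (fun w => b w 0 i) z * eta 0 i * eta 0 l)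
     - 2 * \sum_(l < n) b z 0 l * Ga l z eta)
  + beta z eta *
    (\sum_(m < n) \sum_(l < n)
       dhol l (bbar_low m) z * (eta 0 m)^* * eta 0 l) = 0.

End AlphaBeta.

Section Finsler.
Variable F : 'rV[cplx R]_n -> 'rV[cplx R]_n -> R.

Definition Lag z eta : cplx R := real_cplx (F z eta ^+ 2).

Definition g z eta : 'M[cplx R]_n :=
  \matrix_(i, j) dhol i (dbar j (Lag z)) eta.

Definition N i j z eta : cplx R :=
  \sum_(m < n) \sum_(l < n)
    invmx (g z eta) m i * dhol j (fun w => g w eta l m) z * eta 0 l.

Definition CF i j k z eta : cplx R := dhol j (N i k z) eta.

Definition G i z eta : cplx R := 2^-1 * \sum_(j < n) N i j z eta * eta 0 j.

Definition BL i j k z eta : cplx R := dhol k (dhol j (G i z)) eta.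

End Finsler.
End Local.

Section FinslerSpaces.
Variables (R : realType) (n : nat) (M : complex_manifold R n).
Implicit Types (a : metric_coef M) (b : form_coef M) (F : tangent_fun M).

(* The part of T'M, in the chart c, on which the metric is considered: all of
   T'M if excl is false, {beta != 0} if excl is true (the case where |beta|
   makes F singular or not smooth at beta = 0). *)
Definition fdom (excl : bool) b (c : chart_index M) :
    set (('rV[cplx R]_n * 'rV[cplx R]_n)%type) :=
  [set x | chart_img c x.1 /\ (excl -> beta (b c) x.1 x.2 != 0)].

Variable D : chart_index M -> set (('rV[cplx R]_n * 'rV[cplx R]_n)%type).

Definition slit (c : chart_index M) := D c `&` [set x | x.2 != 0].

Record complex_finsler F : Prop := ComplexFinsler {
  finsler_cont : forall c x, D c x ->
    {for x, continuous (fun y : ('rV[cplx R]_n * 'rV[cplx R]_n)%type => F c y.1 y.2)} ;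
  finsler_ge0 : forall c z eta, D c (z, eta) -> 0 <= F c z eta ;
  finsler_eq0 : forall c z eta, D c (z, eta) -> (F c z eta = 0 <-> eta = 0) ;
  finsler_homog : forall c z eta (lam : cplx R),
    D c (z, eta) -> D c (z, lam *: eta) ->
    F c z (lam *: eta) = re `|lam| * F c z eta ;
  finsler_smooth : forall c,
    smooth_on (slit c) (fun y : ('rV[cplx R]_n * 'rV[cplx R]_n)%type => F c y.1 y.2 ^+ 2) ;
  finsler_pos_def : forall c z eta, slit c (z, eta) -> pos_def (g (F c) z eta) ;
  finsler_chart : forall c d z eta, overlap c d z -> D c (z, eta) ->
    F c z eta = F d (transition c d z) (eta *m trans_jac c d z)
}.

Definition of_alpha_beta a b F : Prop :=
  exists phi : R -> R -> R, forall c z eta, D c (z, eta) ->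
    F c z eta = phi (alpha (a c) z eta) (abs_beta (b c) z eta).

Definition generalized_berwald F : Prop :=
  forall c i j k z eta eta', slit c (z, eta) -> slit c (z, eta') ->
    BL (F c) i j k z eta = BL (F c) i j k z eta'.

Definition kahler_finsler F : Prop :=
  forall c i k z eta, slit c (z, eta) ->
    \sum_(j < n) (CF (F c) i j k z eta - CF (F c) i k j z eta) * eta 0 j = 0.

Definition complex_berwald F : Prop :=
  kahler_finsler F /\
  forall c i j k z eta eta', slit c (z, eta) -> slit c (z, eta') ->
    CF (F c) i j k z eta = CF (F c) i j k z eta'.

Definition on_slit (P : chart_index M ->
    'rV[cplx R]_n -> 'rV[cplx R]_n -> Prop) : Prop :=
  forall c z eta, slit c (z, eta) -> P c z eta.

End FinslerSpaces.

Definition kahler_metric (R : realType) (n : nat) (M : complex_manifold R n)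
    (a : metric_coef M) : Prop :=
  forall c i j k z, chart_img c z ->
    dhol k (fun w => a c w i j) z = dhol i (fun w => a c w k j) z.

(* Main.v *)
(** Where [b <> 0], the hypothesis on [|beta|^2], polarized in [eta], turns each
    of the four conditions into the same identity [rank_one] for the derivatives
    of [conj b]. That identity says that the horizontal fields
    [delta_j = d/dz^j - Na^k_j d/deta^k] of the Chern connection of [a], which
    always annihilate [alpha^2], annihilate [|beta|^2] as well; hence they
    annihilate [L = F^2]. As [phi] may be irregular, this is shown without a chain
    rule for [phi]: if [beta <> 0] and [eta] is not proportional to [b], then
    along a horizontal line [L] equals its restriction to one fibre, evaluated at
    a point moving with zero initial velocity. If [n > 1] and [b <> 0], such
    [eta] are dense. In dimension one, or near a zero of [b] around which [b]
    vanishes, the ratio [|beta|^2 / alpha^2] is locally constant and the same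
    comparison works; the other zeros of [b] are reached by continuity.
    Differentiating [delta_j L = 0] in [conj eta], together with Euler's identity
    for [L], gives [N = Na]. Hence [CF] is the Chern connection of [a], which
    does not depend on [eta], and it is symmetric if [a] is Kaehler. *)

Require Import Defs.
From HB Require Import structures.
From mathcomp Require Import all_boot all_order all_algebra.
From mathcomp Require Import perm complex.
From mathcomp Require Import all_classical all_reals all_analysis.
From mathcomp Require Import ring lra.

Set Implicit Arguments.
Unset Strict Implicit.
Unset Printing Implicit Defensive.

Import Order.TTheory GRing.Theory Num.Theory numFieldNormedType.Exports.

Local Open Scope classical_set_scope.
Local Open Scope ring_scope.

(** * Derivatives along real lines *)

(** [smooth_on] speaks only of iterated derivatives along real lines. Linearity in the direction,
    symmetry of second derivatives and a chain rule are therefore derived from the mean value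
    theorem on lines and the continuity of the derivatives. A chain rule in two directions is
    enough: the two numbers alpha and |beta| are matched by rescaling two orthogonal components of
    [eta], one along b^i and one across it. The scaling factors are square roots of ratios whose
    denominators are the initial squared sizes of these components, so both must be nonzero; this is
    where the genericity of [eta] comes from. When [excl] is true, the hypotheses are known only
    where beta <> 0. Every passage from identities in [eta] to identities between coefficients is
    therefore a polarization on the complement of a hyperplane, which serves both values of [excl].
    In the last step, Euler's identity turns the contraction of g with [eta] into dL/d(conj eta).
    Since [Na] is holomorphic in [eta], a derivative in conj [eta] passes through it and falls on L
    alone. *)

Section RealCplx.
Variable R : realType.
Implicit Types (x y : R) (w : cplx R).

Lemma reD w1 w2 : re (w1 + w2) = re w1 + re w2.
Proof. by case: w1; case: w2. Qed.
Lemma imD w1 w2 : im (w1 + w2) = im w1 + im w2.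
Proof. by case: w1; case: w2. Qed.
Lemma reM w1 w2 : re (w1 * w2) = re w1 * re w2 - im w1 * im w2.
Proof. by case: w1; case: w2. Qed.
Lemma imM w1 w2 : im (w1 * w2) = re w1 * im w2 + im w1 * re w2.
Proof. by case: w1; case: w2. Qed.
Lemma re_conj w : re w^* = re w.
Proof. by case: w. Qed.
Lemma im_conj w : im w^* = - im w.
Proof. by case: w. Qed.

Lemma cplxP w1 w2 : re w1 = re w2 -> im w1 = im w2 -> w1 = w2.
Proof. by case: w1; case: w2 => ? ? ? ? /= -> ->. Qed.


Lemma real_cplx0 : real_cplx 0 = 0 :> cplx R. Proof. by []. Qed.

Lemma real_cplx1 : real_cplx 1 = 1 :> cplx R. Proof. by []. Qed.

Lemma real_cplxD x y : real_cplx (x + y) = real_cplx x + real_cplx y.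
Proof. by apply: cplxP; rewrite ?reD ?imD /= ?addr0. Qed.

Lemma real_cplxM x y : real_cplx (x * y) = real_cplx x * real_cplx y.
Proof. by apply: cplxP; rewrite ?reM ?imM /= !(mulr0, mul0r, subr0, addr0). Qed.

Lemma real_cplxN x : real_cplx (- x) = - real_cplx x.
Proof. by apply: (addIr (real_cplx x)); rewrite -real_cplxD !addNr. Qed.

Lemma real_cplxB x y : real_cplx (x - y) = real_cplx x - real_cplx y.
Proof. by rewrite real_cplxD real_cplxN. Qed.

Lemma real_cplx_norm x : `|real_cplx x| = real_cplx `|x|.
Proof.
rewrite [LHS](@normc_def R) /= expr0n /= addr0 sqrtr_sqr.
by [].
Qed.

Lemma ltr_real_cplx x y : (real_cplx x < real_cplx y) = (x < y).
Proof. by rewrite /real_cplx [LHS](@ltcE R) /= eqxx. Qed.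

Lemma ler_real_cplx x y : (real_cplx x <= real_cplx y) = (x <= y).
Proof. by rewrite /real_cplx [LHS](@lecE R) /= eqxx. Qed.

Lemma real_cplx_inj : injective (@real_cplx R).
Proof. by move=> x y []. Qed.

Lemma re_im w : w = real_cplx (re w) + iunit R * real_cplx (im w).
Proof.
by apply: cplxP; rewrite ?reD ?imD ?reM ?imM /= !(mul0r,mul1r,mulr0,subr0,addr0,add0r).
Qed.

Lemma iunit2 : iunit R * iunit R = -1.
Proof.
by apply: cplxP; rewrite ?reM ?imM /=; rewrite !(mul0r,mulr0,mulr1,addr0,sub0r) ?oppr0.
Qed.

Lemma conj_iunit : (iunit R)^* = - iunit R.
Proof. by apply: cplxP; rewrite ?re_conj ?im_conj /= ?oppr0. Qed.

Lemma conj_real_cplx x : (real_cplx x)^* = real_cplx x.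
Proof. by apply: cplxP; rewrite ?re_conj ?im_conj /= ?oppr0. Qed.

Lemma gt0_cplx w : 0 < w -> w = real_cplx (re w) /\ 0 < re w.
Proof.
by case: w => x y; rewrite [_ < _](@ltcE R) /= => /andP[/eqP -> ?]; split.
Qed.

Lemma continuous_real_cplx : continuous (@real_cplx R : R -> cplx R).
Proof.
move=> x; apply/cvgrPdist_lt => e /gt0_cplx [-> e0].
near=> y.
rewrite -real_cplxB real_cplx_norm ltr_real_cplx.
near: y.
by apply/nbhs_normP; exists (re e).
Unshelve. all: by end_near. Qed.

End RealCplx.

Section RealLines.
Variables (R : realType) (E : normedModType (cplx R)).
Implicit Types (x u v : E) (A : set E) (f : E -> R) (s t : R).

Lemma real_line0 x v : real_line x v 0 = x.
Proof. by rewrite /real_line real_cplx0 scale0r addr0. Qed.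

Lemma real_lineD x v s t : real_line (real_line x v s) v t = real_line x v (s + t).
Proof. by rewrite /real_line real_cplxD scalerDl addrA. Qed.

Lemma real_lineC x u v s t :
  real_line (real_line x u s) v t = real_line (real_line x v t) u s.
Proof. by rewrite /real_line addrAC. Qed.

Lemma near0_norm_lt (d : R) : 0 < d -> \forall t \near (0 : R), `|t| < d.
Proof.
move=> d0; apply/nbhs_normP; exists d => // t.
by rewrite /ball_ /= sub0r normrN.
Qed.

Lemma near_real_line2 A x u v : nbhs x A ->
  exists2 d : R, 0 < d & forall s t, `|s| < d -> `|t| < d ->
    A (real_line (real_line x u s) v t).
Proof.
move=> /nbhs_normP[e /gt0_cplx [-> e0]] eA.
(* The summand 1 makes [C] positive even if [u = v = 0], and leaves the slack [re e / C] that makes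
   the final estimate strict. *)
pose C : R := re (`|u| + `|v|) + 1.
have nE w : `|w : E| = real_cplx (re `|w|).
  have := normr_ge0 w; rewrite le_eqVlt => /orP[/eqP <-//|/gt0_cplx[]//].
have n0 w : 0 <= re `|w : E| by rewrite -ler_real_cplx -nE normr_ge0.
have C0 : 0 < C by rewrite /C reD ltr_wpDl// addr_ge0.
exists (re e / C); first by rewrite divr_gt0.
move=> s t sd td; apply: eA.
rewrite /= /ball_ /real_line.
rewrite -addrA opprD addNKr normrN.
apply: (le_lt_trans (ler_normD _ _)).
rewrite !normrZ !real_cplx_norm (nE u) (nE v) -!real_cplxM -real_cplxD ltr_real_cplx.
have -> : re e = re e / C * re `|u| + re e / C * re `|v| + re e / C.
  by rewrite -[X in _ + X]mulr1 -!mulrDr -/C -reD mulfVK// gt_eqF.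
have h (a : R) w : `|a| < re e / C -> `|a| * re `|w : E| <= re e / C * re `|w|.
  by move=> /ltW ha; rewrite ler_wpM2r.
rewrite ltr_pwDr ?divr_gt0// lerD ?h//.
Qed.

Lemma near_real_line A x v : nbhs x A -> \forall t \near (0 : R), A (real_line x v t).
Proof.
move=> /near_real_line2 - /(_ 0 v) [d d0 H].
near=> t; rewrite -[x](real_line0 x 0); apply: H; first by rewrite normr0.
by near: t; apply: near0_norm_lt.
Unshelve. all: by end_near. Qed.

Definition line_derivable v f x := derivable (fun t : R => f (real_line x v t)) 0 1.

Lemma rderP v f x : line_derivable v f x ->
  is_derive (0 : R) 1 (fun t => f (real_line x v t)) (rder v f x).
Proof. by move=> H; rewrite /rder derive1E; apply/derivableP. Qed.

Lemma rder_val v f x d : is_derive (0 : R) 1 (fun t => f (real_line x v t)) d ->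
  line_derivable v f x /\ rder v f x = d.
Proof. by move=> [H1 H2]; split => //; rewrite /rder derive1E. Qed.

Lemma is_derive_line v f x s : line_derivable v f (real_line x v s) ->
  is_derive s 1 (fun t => f (real_line x v t)) (rder v f (real_line x v s)).
Proof.
move=> /rderP H.
have -> : (fun t => f (real_line x v t)) =
   (fun t => f (real_line (real_line x v s) v t)) \o shift (- s).
  by apply/funext => t /=; rewrite real_lineD addrC subrK.
rewrite -[rder _ _ _]mulr1; apply: is_derive1_comp; last exact: is_derive_shift.
by rewrite /= subrr.
Qed.

(** The bound by absolute values covers both signs of [t]; later only the convergence of [c] to 0
    together with [t] matters. *)
Lemma line_MVT v f x t :
  (forall r, `|r| <= `|t| -> line_derivable v f (real_line x v r)) ->
  exists2 c, `|c| <= `|t| &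
    f (real_line x v t) - f x = rder v f (real_line x v c) * t.
Proof.
move=> H.
have D (r : R) : `|r| <= `|t| -> is_derive r 1 (fun t => f (real_line x v t)) (rder v f (real_line x v r)).
  by move=> /H /is_derive_line.
have cont a b : (forall r, a <= r <= b -> `|r| <= `|t|) ->
    {within `[a, b], continuous (fun t => f (real_line x v t))}.
  move=> h; apply: derivable_within_continuous => r; rewrite in_itv /= => /h /D.
  by case.
have [t0|t0] := leP 0 t.
  have h r : 0 <= r <= t -> `|r| <= `|t|.
    by move=> /andP[r0 rt]; rewrite !ger0_norm.
  have [||c ct] := @MVT_segment R (fun t => f (real_line x v t))
     (fun r => rder v f (real_line x v r)) 0 t t0.
  - by move=> r; rewrite in_itv /= => /andP[r0 rt]; apply: D; apply: h; rewrite !ltW.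
  - exact: cont.
  by rewrite real_line0 subr0 => ->; exists c => //; apply: h; move: ct; rewrite in_itv.
have h r : t <= r <= 0 -> `|r| <= `|t|.
  by move=> /andP[r0 rt]; rewrite !ler0_norm ?lerN2// ltW.
have [||c ct] := @MVT_segment R (fun t => f (real_line x v t))
   (fun r => rder v f (real_line x v r)) t 0 (ltW t0).
- by move=> r; rewrite in_itv /= => /andP[r0 rt]; apply: D; apply: h; rewrite !ltW.
- exact: cont.
rewrite real_line0 sub0r => E1; exists c; first by apply: h; move: ct; rewrite in_itv.
by rewrite -opprB E1 mulrN opprK.
Qed.

End RealLines.

(** * The chain rule for a displacement in two directions *)

Section DirectionalCalculus.
Variables (R : realType) (E : normedModType (cplx R)).
Implicit Types (x u v w : E) (A : set E) (f : E -> R) (s t : R).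

Lemma cvg_real_line2 {T} (F : set_system T) {FF : Filter F} x u v (c c' : T -> R) :
  c t @[t --> F] --> 0 -> c' t @[t --> F] --> 0 ->
  real_line (real_line x u (c t)) v (c' t) @[t --> F] --> x.
Proof.
move=> hc hc' A /near_real_line2 - /(_ u v) [d d0 H].
have h : forall c : T -> R, c t @[t --> F] --> 0 -> \forall t \near F, `|c t| < d.
  move=> e he; exact: (he _ (near0_norm_lt d0)).
have FF' : Filter (nbhs F) := FF.
by apply: filterS2 (h _ hc) (h _ hc') => t ? ?; exact: H.
Qed.

(** Move first along [u], then along [v], and apply the mean value theorem to each leg. The
    intermediate points tend to [x], where both directional derivatives are continuous, so the
    Caratheodory slope converges. *)
Lemma chain_rule2 A f x u v (p q : R -> R) dp dq :
  nbhs x A ->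
  (forall y, A y -> line_derivable u f y) ->
  (forall y, A y -> line_derivable v f y) ->
  {for x, continuous (rder u f)} -> {for x, continuous (rder v f)} ->
  p 0 = 0 -> q 0 = 0 ->
  is_derive (0 : R) 1 p dp -> is_derive (0 : R) 1 q dq ->
  is_derive (0 : R) 1 (fun t => f (real_line (real_line x u (p t)) v (q t)))
    (dp * rder u f x + dq * rder v f x).
Proof.
move=> xA du dv cu cv p0 q0 Dp Dq.
have [d d0 HA] := near_real_line2 u v xA.
have cont0 (r : R -> R) dr : r 0 = 0 -> is_derive (0 : R) 1 r dr -> r t @[t --> 0] --> 0.
  move=> r0 [Dr _]; rewrite -[X in _ --> X]r0.
  exact/differentiable_continuous/derivable1_diffP.
have cp := cont0 _ _ p0 Dp; have cq := cont0 _ _ q0 Dq.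
have [P [HP cP P0]] := (@is_derive1_caratheodory R p 0 dp).1 Dp.
have [Q [HQ cQ Q0]] := (@is_derive1_caratheodory R q 0 dq).1 Dq.
pose X t := real_line (real_line x u (p t)) v (q t).
(* Intermediate points for all [t] at once. Where the displacement may leave [A] the pair (0, 0) is
   a mere default, which still satisfies the two bounds. *)
have /choice[c Hc] : forall t, exists c : R * R,
    [/\ `|c.1| <= `|p t|, `|c.2| <= `|q t| &
     `|p t| < d -> `|q t| < d ->
     f (X t) - f x = rder u f (real_line x u c.1) * p t
       + rder v f (real_line (real_line x u (p t)) v c.2) * q t].
  move=> t; have [pd|] := ltP `|p t| d; last by exists (0, 0); split=> //=; rewrite ?normr0.
  have [qd|] := ltP `|q t| d; last by exists (0, 0); split=> //=; rewrite ?normr0.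
  have [r rp|c1 c1p E1] := @line_MVT R E u f x (p t).
    apply: du; rewrite -[real_line _ _ _](real_line0 _ v); apply: HA; rewrite ?normr0//.
    exact: le_lt_trans rp _.
  have [r rp|c2 c2p E2] := @line_MVT R E v f (real_line x u (p t)) (q t).
    by apply: dv; apply: HA => //; exact: le_lt_trans rp _.
  by exists (c1, c2); split=> // _ _; rewrite -E1 -E2 /X; ring.
(* The slope of the composite. The second branch is the plain difference quotient, so that the slope
   equation also holds far from 0; continuity at 0 only concerns the first branch. *)
pose g t := if (`|p t| < d) && (`|q t| < d) then
   rder u f (real_line x u (c t).1) * P t
       + rder v f (real_line (real_line x u (p t)) v (c t).2) * Q t
   else (f (X t) - f x) / t.
have X0 : X 0 = x by rewrite /X p0 q0 !real_line0.
have sq (r r' : R -> R) : (forall t, `|r t| <= `|r' t|) -> r' t @[t --> 0] --> 0 -> r t @[t --> 0] --> 0.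
  move=> rr /cvgrPdist_lt H; apply/cvgrPdist_lt => e /H.
  apply: filterS => t; rewrite !sub0r !normrN; exact: le_lt_trans.
have cc1 : (c t).1 @[t --> 0] --> 0 by apply: (sq _ p) => // t; case: (Hc t).
have cc2 : (c t).2 @[t --> 0] --> 0 by apply: (sq _ q) => // t; case: (Hc t).
have c00 : (c 0).1 = 0 /\ (c 0).2 = 0.
  by case: (Hc 0); rewrite p0 q0 normr0 !normr_le0 => /eqP -> /eqP ->.
have g0 : g 0 = dp * rder u f x + dq * rder v f x.
  rewrite /g p0 q0 normr0 d0 /= c00.1 c00.2 !real_line0 P0 Q0.
  by rewrite mulrC [X in _ + X]mulrC.
apply/is_derive1_caratheodory; exists g; split => //.
- move=> t; rewrite -/(X t) -/(X 0) X0 /g subr0; case: ifPn => [/andP[pd qd]|].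
    have [_ _ ->//] := Hc t.
    rewrite mulrDl -!mulrA; congr (_ * _ + _ * _).
      by have := HP t; rewrite p0 !subr0.
    by have := HQ t; rewrite q0 !subr0.
  move=> H; rewrite divfK//; apply: contraNneq H => ->.
  by rewrite p0 q0 normr0 d0.
have np : \forall t \near (0 : R), `|p t| < d by exact: (cp _ (near0_norm_lt d0)).
have nq : \forall t \near (0 : R), `|q t| < d by exact: (cq _ (near0_norm_lt d0)).
change (g t @[t --> (0 : R)] --> g 0); rewrite g0.
have : rder u f (real_line x u (c t).1) * P t
       + rder v f (real_line (real_line x u (p t)) v (c t).2) * Q t @[t --> 0] -->
   rder u f x * P 0 + rder v f x * Q 0.
  apply: cvgD; apply: cvgM => //.
    have := @cvg_real_line2 R (nbhs (0 : R)) (nbhs_filter (0 : R)) x u 0 _ (cst 0) cc1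
      (@cvg_cst _ _ _ (nbhs (0 : R)) (nbhs_filter (0 : R))).
    under eq_fun do rewrite /= real_line0.
    by move=> h; exact: (cvg_comp _ _ h cu).
  have h := @cvg_real_line2 R (nbhs (0 : R)) (nbhs_filter (0 : R)) x u v _ _ cp cc2.
  exact: (cvg_comp _ _ h cv).
rewrite P0 Q0 mulrC [X in _ + X]mulrC; apply: cvg_trans; apply: near_eq_cvg.
by near=> t; rewrite /g ifT//; apply/andP; split; near: t.
Unshelve. all: by end_near. Qed.

End DirectionalCalculus.

Lemma is_derive_comb (R : realType) (p q : R -> R) (a b x dp dq : R) :
  is_derive x 1 p dp -> is_derive x 1 q dq ->
  is_derive x 1 (fun t => a * p t + b * q t) (a * dp + b * dq).
Proof. by move=> Dp Dq; apply: is_deriveD; apply: is_deriveZ. Qed.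

(** * Linearity and symmetry of iterated directional derivatives *)

Section SmoothFunctions.
Variables (R : realType) (E : normedModType (cplx R)).
Implicit Types (x u v w : E) (A : set E) (f g : E -> R) (s t : R).

Lemma open_near A x : open A -> A x -> \forall y \near x, A y.
Proof. by move=> oA Ax; move: oA; rewrite openE => /(_ x Ax). Qed.

Lemma line_derivable_near f g v x : (\forall y \near x, f y = g y) ->
  line_derivable v f x -> line_derivable v g x /\ rder v f x = rder v g x.
Proof.
move=> /(near_real_line v) fg /rderP H.
have := near_eq_is_derive fg H.
by move=> /rder_val[? <-]; split.
Qed.

Lemma rder_near f g v x : (\forall y \near x, f y = g y) ->
  rder v f x = rder v g x.
Proof.
move=> /(near_real_line v) fg; rewrite /rder !derive1E.
exact: near_eq_derive.
Qed.

Lemma smooth_derivable A f vs v x : smooth_on A f -> A x ->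
  line_derivable v (foldr (@rder R E) f vs) x.
Proof. by move=> sf Ax; have [_] := sf vs x Ax; apply. Qed.

Lemma smooth_continuous A f vs x : smooth_on A f -> A x ->
  {for x, continuous (foldr (@rder R E) f vs)}.
Proof. by move=> sf Ax; have [] := sf vs x Ax. Qed.

Lemma smooth_rder A f v : smooth_on A f -> smooth_on A (rder v f).
Proof.
move=> sf vs x Ax; have := sf (rcons vs v) x Ax.
by rewrite foldr_rcons.
Qed.

Lemma foldr_rder_comb A f g (a b : R) vs x : open A -> smooth_on A f -> smooth_on A g -> A x ->
  foldr (@rder R E) (fun y => a * f y + b * g y) vs x =
    a * foldr (@rder R E) f vs x + b * foldr (@rder R E) g vs x.
Proof.
move=> oA sf sg; elim: vs x => [|v vs IH] x Ax //=.
rewrite (@rder_near _ (fun y => a * foldr (@rder R E) f vs y + b * foldr (@rder R E) g vs y)); last first.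
  by apply: filterS (open_near oA Ax) => y; exact: IH.
have /rderP Df := @smooth_derivable A f vs v x sf Ax.
have /rderP Dg := @smooth_derivable A g vs v x sg Ax.
apply: (proj2 (@rder_val R E v (fun y => a * foldr (@rder R E) f vs y +
  b * foldr (@rder R E) g vs y) x _ _)).
Qed.

Lemma smooth_comb A f g (a b : R) : open A -> smooth_on A f -> smooth_on A g ->
  smooth_on A (fun y => a * f y + b * g y).
Proof.
move=> oA sf sg vs x Ax.
have H : \forall y \near x, a * foldr (@rder R E) f vs y + b * foldr (@rder R E) g vs y =
     foldr (@rder R E) (fun y => a * f y + b * g y) vs y.
  by apply: filterS (open_near oA Ax) => y Ay; rewrite (@foldr_rder_comb A).
split.
  rewrite /prop_for /continuous_at (@foldr_rder_comb A)//.
  apply: cvg_trans; first exact: (near_eq_cvg H).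
  by apply: cvgD; apply: cvgMr; exact: (@smooth_continuous A).
move=> v; apply: (proj1 (line_derivable_near H _)).
have /rderP Df := @smooth_derivable A f vs v x sf Ax.
have /rderP Dg := @smooth_derivable A g vs v x sg Ax.
by have [] := is_derive_comb a b Df Dg.
Qed.

(** Existence of directional derivatives alone would not give this; it is [chain_rule2] with linear
    displacements, and rests on the continuity of the derivatives. *)
Lemma rder_comb A f u v (a b : R) x : open A -> smooth_on A f -> A x ->
  rder (real_cplx a *: u + real_cplx b *: v) f x = a * rder u f x + b * rder v f x.
Proof.
move=> oA sf Ax.
have D (c : R) : is_derive (0 : R) 1 (fun t : R => c * t) c.
  by rewrite -[X in is_derive _ _ _ X]mulr1; apply: is_deriveZ.
have := @chain_rule2 R E A f x u v (fun t => a * t) (fun t => b * t) a b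
  (open_near oA Ax) _ _ _ _ (mulr0 _) (mulr0 _) (D a) (D b).
move=> H; apply: (proj2 (rder_val _)).
suff <- : (fun t : R => f (real_line (real_line x u (a * t)) v (b * t))) =
  (fun t : R => f (real_line x (real_cplx a *: u + real_cplx b *: v) t)).
  apply: H.
  - by move=> y; exact: (@smooth_derivable A f [::]).
  - by move=> y; exact: (@smooth_derivable A f [::]).
  - exact: (@smooth_continuous A f [:: u]).
  - exact: (@smooth_continuous A f [:: v]).
apply/funext => t; rewrite /real_line !real_cplxM scalerDr !scalerA addrA.
by rewrite [real_cplx t * _]mulrC [X in _ + X *: v]mulrC.
Qed.

(** Two applications of the mean value theorem: to y |-> f (y + s v) - f y in the direction [u],
    then to the derivative of [f] along [u] in the direction [v]. *)
Lemma mixed_difference f u v x s :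
  (forall r t, `|r| <= `|s| -> `|t| <= `|s| ->
     line_derivable u f (real_line (real_line x u r) v t) /\
     line_derivable v (rder u f) (real_line (real_line x u r) v t)) ->
  exists c : R * R, [/\ `|c.1| <= `|s|, `|c.2| <= `|s| &
   f (real_line (real_line x u s) v s) - f (real_line x u s) - (f (real_line x v s) - f x)
    = rder v (rder u f) (real_line (real_line x u c.1) v c.2) * s * s].
Proof.
move=> H; pose h y := f (real_line y v s) - f y.
have Dh (r : R) : `|r| <= `|s| -> is_derive (0 : R) 1 (fun t => h (real_line (real_line x u r) u t))
    (rder u f (real_line (real_line x u r) v s) - rder u f (real_line x u r)).
  move=> rs; have [/rderP D1 _] := H r s rs (lexx _).
  have s0 : `|0 : R| <= `|s| by rewrite normr0.
  have [/rderP D2 _] := H r 0 rs s0.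
  rewrite real_line0 in D2.
  have := is_deriveB D1 D2.
  by under [X in is_derive _ _ X]eq_fun do rewrite /= real_lineC.
have [r /Dh /rder_val[]//|c1 c1s] := @line_MVT R E u h x s.
have [_ ->] := rder_val (Dh _ c1s).
have [r rs|c2 c2s ->] := @line_MVT R E v (rder u f) (real_line x u c1) s.
  by have [] := H c1 r c1s rs.
by rewrite /h => E1; exists (c1, c2); split => //=; rewrite -E1.
Qed.

(** Schwarz's argument: the second difference is symmetric in [u] and [v], and divided by s^2 it
    tends to either of the two mixed derivatives. *)
Lemma rder_comm A f u v x : open A -> smooth_on A f -> A x ->
  rder u (rder v f) x = rder v (rder u f) x.
Proof.
move=> oA sf Ax.
have half w w' : exists c : R -> R * R, (forall s, `|(c s).1| <= `|s| /\ `|(c s).2| <= `|s|)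
   /\ \forall s \near (0 : R),
   f (real_line (real_line x w s) w' s) - f (real_line x w s) - (f (real_line x w' s) - f x)
    = rder w' (rder w f) (real_line (real_line x w (c s).1) w' (c s).2) * s * s.
  have [d d0 HA] := near_real_line2 w w' (open_near oA Ax).
  have /choice[c Hc] : forall s : R, exists c : R * R, [/\ `|c.1| <= `|s|, `|c.2| <= `|s| &
    `|s| < d ->
   f (real_line (real_line x w s) w' s) - f (real_line x w s) - (f (real_line x w' s) - f x)
    = rder w' (rder w f) (real_line (real_line x w c.1) w' c.2) * s * s].
    move=> s; have [sd|] := ltP `|s| d; last by exists (0, 0); split=> //=; rewrite ?normr0.
    have [r t rs ts|c [? ? ?]] := @mixed_difference f w w' x s; last by exists c.
    have Ay := HA r t (le_lt_trans rs sd) (le_lt_trans ts sd).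
    split; first exact: (@smooth_derivable A f [::]).
    exact: (@smooth_derivable A f [:: w]).
  exists c; split; first by move=> s; have [] := Hc s.
  by apply: filterS (near0_norm_lt d0) => s sd; have [_ _] := Hc s; apply.
have lim w w' (c : R -> R * R) : (forall s, `|(c s).1| <= `|s| /\ `|(c s).2| <= `|s|) ->
   rder w' (rder w f) (real_line (real_line x w (c s).1) w' (c s).2) @[s --> (0 : R)^'] -->
     rder w' (rder w f) x.
  move=> cs.
  have sq (r : R -> R) : (forall s, `|r s| <= `|s|) -> r s @[s --> (0 : R)^'] --> 0.
    move=> rr; apply: cvg_within_filter; apply/cvgrPdist_lt => e e0.
    apply: filterS (near0_norm_lt e0) => s; rewrite !sub0r !normrN; exact: le_lt_trans.
  have h := @cvg_real_line2 R E R ((0:R)^') (dnbhs_filter _) x w w' _ _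
   (sq _ (fun s => proj1 (cs s))) (sq _ (fun s => proj2 (cs s))).
  exact: (cvg_comp _ _ h (@smooth_continuous A f [:: w'; w] x sf Ax)).
have [c [cs Hc]] := half u v; have [c' [cs' Hc']] := half v u.
have h1 := lim u v _ cs; have h2 := lim v u _ cs'.
apply: (norm_cvg_unique h2); apply: cvg_trans h1; apply: near_eq_cvg.
apply: (@filterS3 R _ (dnbhs_filter (0 : R)) _ _ _ _ _
  (nbhs_dnbhs Hc) (nbhs_dnbhs Hc') (nbhs_dnbhs_neq (0 : R))) => s E1 E2 s0.
apply: (mulIf s0); apply: (mulIf s0).
rewrite -[LHS]E1 -[RHS]E2 real_lineC; ring.
Qed.

End SmoothFunctions.

(** * Complex directional derivatives *)

Section ComplexDirectional.
Variables (R : realType) (E : normedModType (cplx R)).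
Implicit Types (x u v w : E) (A : set E) (f g : E -> cplx R) (p q c d : cplx R).

(** [cder] is total and returns a value even where no derivative exists; this predicate also records
    existence, which the product rule needs. *)
Definition has_cder v f x d :=
  is_derive (0 : R) 1 (fun t => re (f (real_line x v t))) (re d) /\
  is_derive (0 : R) 1 (fun t => im (f (real_line x v t))) (im d).

Lemma has_cder_val v f x d : has_cder v f x d -> cder v f x = d.
Proof.
move=> [h1 h2]; apply: cplxP.
  exact: (proj2 (@rder_val R E v (@re R \o f) x _ h1)).
exact: (proj2 (@rder_val R E v (@im R \o f) x _ h2)).
Qed.

Lemma has_cder_near v f g x d : (\forall y \near x, f y = g y) ->
  has_cder v f x d -> has_cder v g x d.
Proof.
move=> /(near_real_line v) fg [h1 h2]; split.
  by apply: near_eq_is_derive h1; apply: filterS fg => t ->.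
by apply: near_eq_is_derive h2; apply: filterS fg => t ->.
Qed.

Lemma has_cder_cst v x c : has_cder v (fun=> c) x 0.
Proof. by split; exact: is_derive_cst. Qed.

Lemma has_cderD v f g x c d : has_cder v f x c -> has_cder v g x d ->
  has_cder v (fun y => f y + g y) x (c + d).
Proof.
move=> [f1 f2] [g1 g2]; split; rewrite ?reD ?imD.
  by under [X in is_derive _ _ X]eq_fun do rewrite reD; exact: is_deriveD.
by under [X in is_derive _ _ X]eq_fun do rewrite imD; exact: is_deriveD.
Qed.

Lemma is_derive_mul (a b : R -> R) (da db : R) :
  is_derive (0 : R) 1 a da -> is_derive (0 : R) 1 b db ->
  is_derive (0 : R) 1 (fun t => a t * b t) (da * b 0 + a 0 * db).
Proof.
move=> Da Db; have := is_deriveM Da Db.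
by rewrite /GRing.scale /= addrC [b 0 * _]mulrC.
Qed.

Lemma has_cderM v f g x c d : has_cder v f x c -> has_cder v g x d ->
  has_cder v (fun y => f y * g y) x (c * g x + f x * d).
Proof.
move=> [f1 f2] [g1 g2]; split.
  under [X in is_derive _ _ X]eq_fun do rewrite reM.
  have := is_deriveB (is_derive_mul f1 g1) (is_derive_mul f2 g2).
  by rewrite !real_line0 => h; apply: (is_derive_eq h); rewrite reD !reM; ring.
under [X in is_derive _ _ X]eq_fun do rewrite imM.
have := is_deriveD (is_derive_mul f1 g2) (is_derive_mul f2 g1).
by rewrite !real_line0 => h; apply: (is_derive_eq h); rewrite imD !imM; ring.
Qed.

Lemma has_cder_conj v f x d : has_cder v f x d -> has_cder v (fun y => (f y)^*) x d^*.
Proof.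
move=> [h1 h2]; split.
  by under [X in is_derive _ _ X]eq_fun do rewrite re_conj; rewrite re_conj.
under [X in is_derive _ _ X]eq_fun do rewrite im_conj; rewrite im_conj.
exact: is_deriveN.
Qed.

Lemma has_cder_real v (r : E -> R) x (d : R) :
  is_derive (0 : R) 1 (fun t => r (real_line x v t)) d ->
  has_cder v (fun y => real_cplx (r y)) x (real_cplx d).
Proof. by move=> h; split => //; exact: is_derive_cst. Qed.

Lemma csmooth_has_cder A v f x : csmooth_on A f -> A x -> has_cder v f x (cder v f x).
Proof.
move=> [s1 s2] Ax; split.
  exact: (rderP (@smooth_derivable R E A (@re R \o f) [::] v x s1 Ax)).
exact: (rderP (@smooth_derivable R E A (@im R \o f) [::] v x s2 Ax)).
Qed.

(** [dhol k] and [dbar k] are the cases of [chol] and [cbar] in which [u] is the [k]-th basis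
    vector. A general direction in a general space is needed to differentiate in (z, eta)
    jointly. *)
Definition chol u f x := 2^-1 * (cder u f x - iunit R * cder (iunit R *: u) f x).
Definition cbar u f x := 2^-1 * (cder u f x + iunit R * cder (iunit R *: u) f x).

(* [p] and [q] are the (1,0) and (0,1) parts of the differential of [f] on the
   complex line spanned by [u]. *)
Definition wirt u f x p q :=
  has_cder u f x (p + q) /\ has_cder (iunit R *: u) f x (iunit R * (p - q)).

Lemma two_neq0 : 2 != 0 :> cplx R.
Proof. by rewrite pnatr_eq0. Qed.

Lemma wirt_val u f x p q : wirt u f x p q -> chol u f x = p /\ cbar u f x = q.
Proof.
move=> [/has_cder_val h1 /has_cder_val h2]; rewrite /chol /cbar h1 h2.
rewrite !mulrA iunit2; have := two_neq0.
by split; field.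
Qed.

Lemma csmooth_wirt A u f x : csmooth_on A f -> A x ->
  wirt u f x (chol u f x) (cbar u f x).
Proof.
move=> sf Ax; split.
  have -> : chol u f x + cbar u f x = cder u f x.
    by rewrite /chol /cbar; field.
  exact: (@csmooth_has_cder A).
have -> : iunit R * (chol u f x - cbar u f x) = cder (iunit R *: u) f x.
  transitivity (- (iunit R * iunit R) * cder (iunit R *: u) f x).
    by rewrite /chol /cbar; field.
  by rewrite iunit2 opprK mul1r.
exact: (@csmooth_has_cder A).
Qed.

Lemma wirt_near u f g x p q : (\forall y \near x, f y = g y) ->
  wirt u f x p q -> wirt u g x p q.
Proof. by move=> fg [h1 h2]; split; exact: has_cder_near fg _. Qed.

Lemma wirt_eq u f x p q p' q' : p = p' -> q = q' -> wirt u f x p q -> wirt u f x p' q'.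
Proof. by move=> -> ->. Qed.

Lemma wirt_cst u x c : wirt u (fun=> c) x 0 0.
Proof. by split; rewrite ?addr0 ?subr0 ?mulr0; exact: has_cder_cst. Qed.

Lemma wirtD u f g x p q p' q' : wirt u f x p q -> wirt u g x p' q' ->
  wirt u (fun y => f y + g y) x (p + p') (q + q').
Proof.
move=> [f1 f2] [g1 g2]; split.
  by rewrite addrACA; exact: has_cderD.
have -> : iunit R * (p + p' - (q + q')) = iunit R * (p - q) + iunit R * (p' - q') by ring.
exact: has_cderD.
Qed.

Lemma wirtM u f g x p q p' q' : wirt u f x p q -> wirt u g x p' q' ->
  wirt u (fun y => f y * g y) x (p * g x + f x * p') (q * g x + f x * q').
Proof.
move=> [f1 f2] [g1 g2]; split.
  have -> : p * g x + f x * p' + (q * g x + f x * q') = (p + q) * g x + f x * (p' + q') by ring.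
  exact: has_cderM.
have -> : iunit R * (p * g x + f x * p' - (q * g x + f x * q')) =
   iunit R * (p - q) * g x + f x * (iunit R * (p' - q')) by ring.
exact: has_cderM.
Qed.

Lemma wirt_conj u f x p q : wirt u f x p q -> wirt u (fun y => (f y)^*) x q^* p^*.
Proof.
move=> [f1 f2]; split.
  by rewrite addrC -rmorphD; exact: has_cder_conj.
have -> : iunit R * (q^* - p^*) = (iunit R * (p - q))^*.
  by rewrite rmorphM rmorphB /= conj_iunit; ring.
exact: has_cder_conj.
Qed.

Lemma wirtZ u f x c p q : wirt u f x p q -> wirt u (fun y => c * f y) x (c * p) (c * q).
Proof.
move=> h; apply: wirt_eq (wirtM (wirt_cst u x c) h); by rewrite mul0r add0r.
Qed.

Lemma wirt_sum (I : finType) u (f : I -> E -> cplx R) x (p q : I -> cplx R) :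
  (forall i, wirt u (f i) x (p i) (q i)) ->
  wirt u (fun y => \sum_i f i y) x (\sum_i p i) (\sum_i q i).
Proof.
move=> H; elim: (index_enum I) => [|i s IH].
  rewrite !big_nil; apply: wirt_near (wirt_cst u x 0).
  by apply: nearW => y; rewrite big_nil.
rewrite !big_cons; apply: wirt_near (wirtD (H i) IH).
by apply: nearW => y; rewrite big_cons.
Qed.

Lemma csmooth_comb A f g c d : open A -> csmooth_on A f -> csmooth_on A g ->
  csmooth_on A (fun y => c * f y + d * g y).
Proof.
move=> oA [f1 f2] [g1 g2].
have S := @smooth_comb R E A.
split.
  have -> : @re R \o (fun y => c * f y + d * g y) =
    (fun y => 1 * (re c * (@re R \o f) y + (- im c) * (@im R \o f) y) +
       1 * (re d * (@re R \o g) y + (- im d) * (@im R \o g) y)).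
    by apply/funext => y; rewrite /= reD !reM !mulNr !mul1r.
  by apply: (S _ _ 1 1 oA); exact: S.
have -> : @im R \o (fun y => c * f y + d * g y) =
    (fun y => 1 * (re c * (@im R \o f) y + im c * (@re R \o f) y) +
       1 * (re d * (@im R \o g) y + im d * (@re R \o g) y)).
    by apply/funext => y; rewrite /= imD !imM !mul1r.
by apply: (S _ _ 1 1 oA); exact: S.
Qed.

Lemma csmooth_cder A f v : csmooth_on A f -> csmooth_on A (cder v f).
Proof.
move=> [f1 f2]; split.
  exact: (smooth_rder v f1).
exact: (smooth_rder v f2).
Qed.

Lemma csmooth_chol A f u : open A -> csmooth_on A f -> csmooth_on A (chol u f).
Proof.
move=> oA sf.
have -> : chol u f = (fun y => 2^-1 * cder u f y + (- (2^-1 * iunit R)) * cder (iunit R *: u) f y).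
  by apply/funext => y; rewrite /chol mulrBr mulNr mulrA.
exact: (csmooth_comb _ _ oA (csmooth_cder _ sf) (csmooth_cder _ sf)).
Qed.

Lemma csmooth_cbar A f u : open A -> csmooth_on A f -> csmooth_on A (cbar u f).
Proof.
move=> oA sf.
have -> : cbar u f = (fun y => 2^-1 * cder u f y + (2^-1 * iunit R) * cder (iunit R *: u) f y).
  by apply/funext => y; rewrite /cbar mulrDr mulrA.
exact: (csmooth_comb _ _ oA (csmooth_cder _ sf) (csmooth_cder _ sf)).
Qed.

Lemma cder_lin A f g c d v x : csmooth_on A f -> csmooth_on A g -> A x ->
  cder v (fun y => c * f y + d * g y) x = c * cder v f x + d * cder v g x.
Proof.
move=> sf sg Ax; apply: has_cder_val.
have h : forall c f, csmooth_on A f -> has_cder v (fun y => c * f y) x (c * cder v f x).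
  move=> c' f' sf'.
  have := has_cderM (has_cder_cst v x c') (@csmooth_has_cder A v f' x sf' Ax).
  by rewrite mul0r add0r.
by apply: has_cderD; exact: h.
Qed.

Lemma cder_comm A f u v x : open A -> csmooth_on A f -> A x ->
  cder u (cder v f) x = cder v (cder u f) x.
Proof.
move=> oA [f1 f2] Ax; apply: cplxP.
  exact: (@rder_comm R E A (@re R \o f)).
exact: (@rder_comm R E A (@im R \o f)).
Qed.

(** Both sides expand into the same four second derivatives, along [u], [i u] and [v], [i v], which
    commute. *)
Lemma chol_cbarC A f u v x : open A -> csmooth_on A f -> A x ->
  chol u (cbar v f) x = cbar v (chol u f) x.
Proof.
move=> oA sf Ax.
have C w w' := @cder_comm A f w w' x oA sf Ax.
have S w := @csmooth_cder A f w sf.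
rewrite {1}/chol /cbar.
have D1 w : cder w (fun y => 2^-1 * (cder v f y + iunit R * cder (iunit R *: v) f y)) x =
   2^-1 * cder w (cder v f) x + 2^-1 * iunit R * cder w (cder (iunit R *: v) f) x.
  have -> : (fun y => 2^-1 * (cder v f y + iunit R * cder (iunit R *: v) f y)) =
      (fun y => 2^-1 * cder v f y + 2^-1 * iunit R * cder (iunit R *: v) f y).
    by apply/funext => y; rewrite mulrDr mulrA.
  exact: (cder_lin (2^-1) (2^-1 * iunit R) w (S v) (S (iunit R *: v)) Ax).
have D2 w : cder w (chol u f) x =
   2^-1 * cder w (cder u f) x + (- (2^-1 * iunit R)) * cder w (cder (iunit R *: u) f) x.
  have -> : chol u f = (fun y => 2^-1 * cder u f y + (- (2^-1 * iunit R)) * cder (iunit R *: u) f y).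
    by apply/funext => y; rewrite /chol mulrBr mulNr mulrA.
  exact: (cder_lin (2^-1) (- (2^-1 * iunit R)) w (S u) (S (iunit R *: u)) Ax).
rewrite !D1 !D2 (C v u) (C v (iunit R *: u)) (C (iunit R *: v) u) (C (iunit R *: v) (iunit R *: u)).
have alg (h i a b c d : cplx R) : h * (h * a + h * i * b - i * (h * c + h * i * d)) =
    h * (h * a + - (h * i) * c + i * (h * b + - (h * i) * d)) by ring.
exact: alg.
Qed.

Lemma cder_comb A f u v (a b : R) x : open A -> csmooth_on A f -> A x ->
  cder (real_cplx a *: u + real_cplx b *: v) f x =
    real_cplx a * cder u f x + real_cplx b * cder v f x.
Proof.
move=> oA [f1 f2] Ax; apply: cplxP.
  rewrite reD !reM /= !mul0r !subr0.
  exact: (@rder_comb R E A (@re R \o f)).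
rewrite imD !imM /= !mul0r !addr0.
exact: (@rder_comb R E A (@im R \o f)).
Qed.

Lemma chol_dirD A f u v x : open A -> csmooth_on A f -> A x ->
  chol (u + v) f x = chol u f x + chol v f x.
Proof.
move=> oA sf Ax.
have D w w' : cder (w + w') f x = cder w f x + cder w' f x.
  by have := @cder_comb A f w w' 1 1 x oA sf Ax; rewrite !scale1r !mul1r.
rewrite /chol scalerDr !D.
have alg (h i a b c d : cplx R) : h * (a + b - i * (c + d)) =
    h * (a - i * c) + h * (b - i * d) by ring.
exact: alg.
Qed.

(** Real linearity handles c u = Re c u + Im c (i u). The combination defining [chol] keeps only the
    (1,0) part of the differential, on which replacing [u] by [i u] amounts to multiplication by
    i. *)
Lemma chol_dirZ A f c u x : open A -> csmooth_on A f -> A x ->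
  chol (c *: u) f x = c * chol u f x.
Proof.
move=> oA sf Ax; rewrite /chol.
have -> : c *: u = real_cplx (re c) *: u + real_cplx (im c) *: (iunit R *: u).
  by rewrite scalerA -scalerDl [real_cplx (im c) * _]mulrC -re_im.
have -> : iunit R *: (real_cplx (re c) *: u + real_cplx (im c) *: (iunit R *: u)) =
   real_cplx (re c) *: (iunit R *: u) + real_cplx (- im c) *: u.
  rewrite scalerDr !scalerA; congr (_ + _); first by rewrite mulrC.
  congr (_ *: u); rewrite real_cplxN -[RHS]mulN1r -iunit2; ring.
rewrite !(cder_comb _ _ _ _ oA sf Ax) real_cplxN [X in _ = X * _]re_im.
have alg (h i r s a b : cplx R) : i * i = -1 ->
    h * (r * a + s * b - i * (r * b + - s * a)) = (r + i * s) * (h * (a - i * b)).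
  move=> i2; transitivity (h * ((r + i * s) * a + (s - i * r) * b)); first by ring.
  rewrite -[X in X - _]opprK -mulN1r -i2; ring.
exact/alg/iunit2.
Qed.

Lemma chol_dir_sum A f (I : finType) (c : I -> cplx R) (u : I -> E) x :
  open A -> csmooth_on A f -> A x ->
  chol (\sum_i c i *: u i) f x = \sum_i c i * chol (u i) f x.
Proof.
move=> oA sf Ax; elim: (index_enum I) => [|i s IH].
  by rewrite !big_nil -(scale0r (0 : E)) (@chol_dirZ A)// mul0r.
by rewrite !big_cons (@chol_dirD A)// (@chol_dirZ A)// IH.
Qed.

Lemma smooth_real_cplx A (r : E -> R) : open A -> smooth_on A r ->
  csmooth_on A (fun y => real_cplx (r y)).
Proof.
move=> oA sr; split; first exact: sr.
have -> : @im R \o (fun y => real_cplx (r y)) = (fun y => 0 * r y + 0 * r y).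
  by apply/funext => y; rewrite /= mul0r addr0.
exact: smooth_comb.
Qed.

Lemma continuous_re_im f x : {for x, continuous (@re R \o f)} ->
  {for x, continuous (@im R \o f)} -> {for x, continuous f}.
Proof.
move=> h1 h2.
have -> : f = (fun y => real_cplx (re (f y)) + iunit R * real_cplx (im (f y))).
  by apply/funext => y; rewrite -re_im.
have rc (r : E -> R) : {for x, continuous r} ->
    real_cplx (r y) @[y --> x] --> real_cplx (r x).
  move=> h; exact: (cvg_comp _ _ h (@continuous_real_cplx R (r x))).
apply: cvgD; first exact: rc h1.
apply: cvgM; first exact: cvg_cst.
exact: rc h2.
Qed.

Lemma csmooth_continuous A f x : csmooth_on A f -> A x -> {for x, continuous f}.
Proof.
move=> [f1 f2] Ax; apply: continuous_re_im.
  exact: (@smooth_continuous R E A (@re R \o f) [::]).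
exact: (@smooth_continuous R E A (@im R \o f) [::]).
Qed.

End ComplexDirectional.

(** * Partial derivatives as derivatives on a product space *)

Section PartialDerivatives.
Variables (R : realType) (E1 E2 : normedModType (cplx R)).
Implicit Types (z v : E1) (eta w : E2).

Lemma real_line_fst z eta v t : real_line (z, eta) (v, 0) t = (real_line z v t, eta).
Proof. by congr pair; rewrite /= scaler0 addr0. Qed.

Lemma real_line_snd z eta w t : real_line (z, eta) (0, w) t = (z, real_line eta w t).
Proof. by congr pair; rewrite /= scaler0 addr0. Qed.

Lemma cder_fst (f : E1 * E2 -> cplx R) v z eta :
  cder v (fun y => f (y, eta)) z = cder (v, 0) f (z, eta).
Proof.
have H (r : cplx R -> R) : (fun t => (r \o (fun y => f (y, eta))) (real_line z v t)) =
    (fun t => (r \o f) (real_line (z, eta) (v, 0) t)).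
  by apply/funext => t; rewrite real_line_fst.
by rewrite /cder /rder !H.
Qed.

Lemma cder_snd (f : E1 * E2 -> cplx R) w z eta :
  cder w (fun y => f (z, y)) eta = cder (0, w) f (z, eta).
Proof.
have H (r : cplx R -> R) : (fun t => (r \o (fun y => f (z, y))) (real_line eta w t)) =
    (fun t => (r \o f) (real_line (z, eta) (0, w) t)).
  by apply/funext => t; rewrite real_line_snd.
by rewrite /cder /rder !H.
Qed.

Lemma scale_fst (c : cplx R) v : c *: (v, 0 : E2) = (c *: v, 0).
Proof. by congr pair; rewrite /= scaler0. Qed.

Lemma scale_snd (c : cplx R) w : c *: (0 : E1, w) = (0, c *: w).
Proof. by congr pair; rewrite /= scaler0. Qed.

Lemma chol_fst (f : E1 * E2 -> cplx R) v z eta :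
  chol v (fun y => f (y, eta)) z = chol (v, 0) f (z, eta).
Proof. by rewrite /chol scale_fst !cder_fst. Qed.

Lemma chol_snd (f : E1 * E2 -> cplx R) w z eta :
  chol w (fun y => f (z, y)) eta = chol (0, w) f (z, eta).
Proof. by rewrite /chol scale_snd !cder_snd. Qed.

Lemma cbar_snd (f : E1 * E2 -> cplx R) w z eta :
  cbar w (fun y => f (z, y)) eta = cbar (0, w) f (z, eta).
Proof. by rewrite /cbar scale_snd !cder_snd. Qed.

Lemma wirt_fst (f : E1 -> cplx R) v w z eta p q : wirt v f z p q ->
  wirt (v, w) (fun y : E1 * E2 => f y.1) (z, eta) p q.
Proof. by move=> []. Qed.

Lemma wirt_snd (f : E2 -> cplx R) v w z eta p q : wirt w f eta p q ->
  wirt (v, w) (fun y : E1 * E2 => f y.2) (z, eta) p q.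
Proof. by move=> []. Qed.

End PartialDerivatives.

Lemma wirt_coord (R : realType) n (u x : 'rV[cplx R]_n) (k : 'I_n) :
  wirt u (fun eta : 'rV[cplx R]_n => eta 0 k) x (u 0 k) 0.
Proof.
have H (v : 'rV[cplx R]_n) : has_cder v (fun eta : 'rV[cplx R]_n => eta 0 k) x (v 0 k).
  have D (a b : R) : is_derive (0 : R) 1 (fun t : R => a + t * b) b.
    rewrite -[X in is_derive _ _ _ X]add0r; apply: is_deriveD.
    have := @is_derive_mul R id (cst b) 1 0 (is_derive_id _ _) (is_derive_cst _ _ _).
    by rewrite /= mulr0 addr0 mul1r.
  split.
    under [X in is_derive _ _ X]eq_fun do rewrite /real_line !mxE reD reM /= mul0r subr0.
    exact: D.
  under [X in is_derive _ _ X]eq_fun do rewrite /real_line !mxE imD imM /= mul0r addr0.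
  exact: D.
split; rewrite ?addr0 ?subr0; first exact: H.
by have := H (iunit R *: u); rewrite mxE.
Qed.

(** * Hermitian forms *)

Section HermitianAlgebra.
Variables (R : realType) (n : nat).
Local Notation C := (cplx R).
Implicit Types (x y eta xi : 'rV[C]_n) (h : 'M[C]_n).

Definition hform h x y : C := \sum_(i < n) \sum_(j < n) h i j * x 0 i * (y 0 j)^*.

Lemma hformDl h x x' y : hform h (x + x') y = hform h x y + hform h x' y.
Proof.
rewrite /hform -big_split; apply: eq_bigr => i _; rewrite -big_split.
by apply: eq_bigr => j _; rewrite mxE mulrDr mulrDl.
Qed.

Lemma hformZl h c x y : hform h (c *: x) y = c * hform h x y.
Proof.
rewrite /hform mulr_sumr; apply: eq_bigr => i _; rewrite mulr_sumr.
by apply: eq_bigr => j _; rewrite mxE mulrCA !mulrA.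
Qed.

Lemma hformDr h x y y' : hform h x (y + y') = hform h x y + hform h x y'.
Proof.
rewrite /hform -big_split; apply: eq_bigr => i _; rewrite -big_split.
by apply: eq_bigr => j _; rewrite mxE rmorphD mulrDr.
Qed.

Lemma hformZr h c x y : hform h x (c *: y) = c^* * hform h x y.
Proof.
rewrite /hform mulr_sumr; apply: eq_bigr => i _; rewrite mulr_sumr.
by apply: eq_bigr => j _; rewrite mxE rmorphM mulrCA !mulrA.
Qed.

Lemma hform0l h y : hform h 0 y = 0.
Proof. by rewrite -(scale0r 0) hformZl mul0r. Qed.

Lemma hform_delta h i j : hform h (delta_mx 0 i) (delta_mx 0 j) = h i j.
Proof.
rewrite /hform (bigD1 i)//= [X in _ + X]big1 ?addr0; last first.
  move=> k ki; rewrite big1// => l _.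
  by rewrite mxE (negbTE ki) andbF mulr0 mul0r.
rewrite (bigD1 j)//= [X in _ + X]big1 ?addr0; last first.
  move=> k ki.
  by rewrite [X in X^*]mxE (negbTE ki) andbF conjC0 mulr0.
by rewrite !mxE !eqxx conjC1 !mulr1.
Qed.

Lemma hform_conj h x y : (forall i j, h i j = (h j i)^*) ->
  (hform h x y)^* = hform h y x.
Proof.
move=> hh; rewrite /hform rmorph_sum /= exchange_big /=.
rewrite exchange_big /=; under eq_bigr do rewrite rmorph_sum /=.
rewrite exchange_big /=; apply: eq_bigr => i _; apply: eq_bigr => j _.
by rewrite !rmorphM /= conjCK -hh mulrAC.
Qed.

Lemma pos_def_unit h : pos_def h -> h \in unitmx.
Proof.
move=> hp; rewrite -row_free_unit -kermx_eq0; apply/negPn/negP.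
move=> /rowV0Pn[v /sub_kermxP vh v0]; have := hp v v0.
suff -> : \sum_(i < n) \sum_(j < n) h i j * v 0 i * (v 0 j)^* = 0 by rewrite ltxx.
rewrite exchange_big big1// => j _; rewrite -mulr_suml.
have /rowP/(_ j) := vh; rewrite !mxE => E.
by under eq_bigr do rewrite mulrC; rewrite E mul0r.
Qed.

Lemma conj_invmx h i j : (forall i j, h i j = (h j i)^*) -> (invmx h i j)^* = invmx h j i.
Proof.
move=> hh; have E : map_mx Num.conj h = h^T.
  by apply/matrixP => k l; rewrite !mxE -hh.
have := congr1 (fun A : 'M[C]_n => A i j) (map_invmx Num.conj h).
by rewrite !mxE E -trmx_inv mxE.
Qed.

(** Polarization: x + y makes the sum of h(x, y) and h(y, x) vanish, and x + i y their
    difference. *)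
Lemma sesquilinear0 h : (forall x, hform h x x = 0) -> h = 0.
Proof.
move=> H; apply/matrixP => i j; rewrite mxE -hform_delta.
move: (delta_mx 0 i) (delta_mx 0 j) => x y.
have E1 : hform h x y + hform h y x = 0.
  by have := H (x + y); rewrite !hformDl !hformDr !H add0r addr0.
have := H (x + iunit R *: y); rewrite !hformDl !hformDr !hformZl !hformZr !H.
rewrite !mulr0 add0r addr0 conj_iunit mulNr addrC -mulrBr => /eqP.
rewrite mulf_eq0 => /orP[/eqP i0|].
  by have := iunit2 R; rewrite i0 mul0r => /eqP; rewrite eq_sym oppr_eq0 oner_eq0.
rewrite subr_eq0 => /eqP E2; move: E1; rewrite E2 => /eqP.
by rewrite -mulr2n mulrn_eq0 => /eqP.
Qed.

Lemma linear_form_delta (b : 'rV[C]_n) i : \sum_k b 0 k * (delta_mx 0 i : 'rV[C]_n) 0 k = b 0 i.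
Proof.
rewrite (bigD1 i)//= [X in _ + X]big1 ?addr0; last first.
  by move=> k ki; rewrite mxE (negbTE ki) andbF mulr0.
by rewrite mxE !eqxx mulr1.
Qed.

Definition lform (b : 'rV[C]_n) x : C := \sum_i b 0 i * x 0 i.

Lemma lformD b x y : lform b (x + y) = lform b x + lform b y.
Proof. by rewrite /lform -big_split; apply: eq_bigr => i _; rewrite mxE mulrDr. Qed.

Lemma lformZ b c x : lform b (c *: x) = c * lform b x.
Proof. by rewrite /lform mulr_sumr; apply: eq_bigr => i _; rewrite mxE mulrCA. Qed.

Lemma lform_neq0 b : b != 0 -> exists x, lform b x != 0.
Proof.
move=> /eqP b0; apply: contrapT => H; apply: b0; apply/rowP => i.
rewrite mxE -linear_form_delta; apply/eqP/negPn/negP => h.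
by apply: H; exists (delta_mx 0 i).
Qed.

(* The complement of a hyperplane spans: of [eta + xi] and [eta - xi] at least
   one lies off the hyperplane whenever [eta] does. *)
Lemma linear_form0 b (X : 'I_n -> C) : b != 0 ->
  (forall x, lform b x != 0 -> \sum_m X m * (x 0 m)^* = 0) -> forall m, X m = 0.
Proof.
move=> /lform_neq0[x0 bx0] H m.
pose f x := \sum_m X m * (x 0 m)^*.
have fD x y : f (x + y) = f x + f y.
  by rewrite /f -big_split; apply: eq_bigr => i _; rewrite mxE rmorphD mulrDr.
have fN x : f (- x) = - f x.
  by rewrite /f -sumrN; apply: eq_bigr => i _; rewrite mxE rmorphN mulrN.
suff : f (delta_mx 0 m) = 0.
  rewrite /f (bigD1 m)//= [X in _ + X]big1 ?addr0.
    by rewrite mxE !eqxx conjC1 mulr1.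
  by move=> k km; rewrite mxE (negbTE km) andbF conjC0 mulr0.
move: (delta_mx 0 m) => y.
have [E|E] := eqVneq (lform b (x0 + y)) 0; last first.
  by have := H _ E; rewrite -/(f _) fD (H x0 bx0 : f x0 = 0) add0r.
have E' : lform b (x0 - y) != 0.
  apply: contraNneq bx0 => E'; have := lformD b (x0 + y) (x0 - y).
  rewrite E E' addr0 addrACA subrr addr0 lformD => /eqP.
  by rewrite -mulr2n mulrn_eq0.
have := H _ E'; rewrite -/(f _) fD fN (H x0 bx0 : f x0 = 0) add0r => /eqP.
by rewrite oppr_eq0 => /eqP.
Qed.

(** With [x0] off the hyperplane, adding the values of the form at x0 + t y and x0 - t y leaves 2
    t^2 h(y, y). It remains to choose a real t <> 0 for which both points lie off the hyperplane. *)
Lemma sesquilinear_dense0 b h : b != 0 ->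
  (forall x, lform b x != 0 -> hform h x x = 0) -> h = 0.
Proof.
move=> /lform_neq0[x0 bx0] H; apply: sesquilinear0 => y.
have good (t : C) : t^* = t -> lform b (x0 + t *: y) != 0 -> lform b (x0 - t *: y) != 0 ->
    t != 0 -> hform h y y = 0.
  move=> tR /H + /H; rewrite -scaleNr !hformDl !hformDr !hformZl !hformZr rmorphN /= tR.
  rewrite (H x0 bx0) !add0r => E1 E2 t0.
  have : 2 * (t * t) * hform h y y = 0.
    by rewrite -[RHS](addr0 (0 : C)) -[X in _ = X + _]E1 -[X in _ = _ + X]E2; ring.
  by move/eqP; rewrite !mulf_eq0 (negbTE t0) pnatr_eq0 => /eqP.
have ne (t : C) : lform b (x0 - t *: y) = lform b x0 - t * lform b y.
  by rewrite -scaleNr lformD lformZ mulNr.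
have [/andP[h1 h2]|] := boolP ((lform b x0 + lform b y != 0) && (lform b x0 - lform b y != 0)).
  by apply: (good 1); rewrite ?conjC1 ?oner_eq0 ?ne ?lformD ?lformZ ?mul1r.
rewrite negb_and !negbK => H0.
(* If t = 1 fails, then b(x0) = b(y) or b(x0) = - b(y). For t = 2 the two values are then, up to
   sign and order, b(y) and 3 b(y), hence nonzero. *)
have [k1 k2] : lform b x0 + 2 * lform b y != 0 /\ lform b x0 - 2 * lform b y != 0.
  move: H0; rewrite addr_eq0 subr_eq0.
  case/orP => /eqP E; move: bx0; rewrite E => y0; last first.
    have -> : lform b y + 2 * lform b y = 3 * lform b y by ring.
    have -> : lform b y - 2 * lform b y = - lform b y by ring.
    by rewrite mulf_neq0 ?oppr_eq0 ?pnatr_eq0.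
  rewrite oppr_eq0 in y0.
  have -> : - lform b y + 2 * lform b y = lform b y by ring.
  have -> : - lform b y - 2 * lform b y = - 3 * lform b y by ring.
  by rewrite mulf_neq0 ?oppr_eq0 ?pnatr_eq0.
by apply: (good 2); rewrite ?conjC_nat ?pnatr_eq0 ?ne ?lformD ?lformZ.
Qed.

End HermitianAlgebra.

(** * The four conditions at a point *)

Section PointwiseConditions.
Variables (R : realType) (n : nat).
Variables (a : 'rV[cplx R]_n -> 'M[cplx R]_n) (b : 'rV[cplx R]_n -> 'rV[cplx R]_n).
Variable z : 'rV[cplx R]_n.
Hypothesis a_herm : forall i j, a z i j = (a z j i)^*.
Hypothesis a_pos : pos_def (a z).
Implicit Types eta xi : 'rV[cplx R]_n.

Local Notation nb := (norm_b2 a b z).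
Local Notation bl := (b z 0).
Local Notation bu i := (b_up a b i z).
Local Notation bbu i := (bbar_up a b i z).
Local Notation dB l i := (dhol l (fun w => b w 0 i) z).
Local Notation dC l m := (dhol l (bbar_low b m) z).
Local Notation dA l r m := (dhol l (fun w => a w r m) z).

Lemma norm_b2_sum : nb = \sum_i bl i * bu i.
Proof.
apply: eq_bigr => i _; rewrite /b_up mulr_sumr; apply: eq_bigr => j _.
by rewrite [RHS]mulrA [X in _ = X * _]mulrC.
Qed.

Lemma bbar_up_sum i : bbu i = \sum_j invmx (a z) i j * bl j.
Proof.
rewrite /bbar_up /b_up rmorph_sum; apply: eq_bigr => j _.
by rewrite rmorphM /= /bbar_low conjCK conj_invmx.
Qed.

Lemma norm_b2_sum_bar : nb = \sum_j (bl j)^* * bbu j.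
Proof.
rewrite /norm_b2 exchange_big; apply: eq_bigr => j _.
rewrite bbar_up_sum mulr_sumr; apply: eq_bigr => i _.
by rewrite /bbar_low mulrC.
Qed.

Lemma b_up_low j : \sum_i a z i j * bu i = (bl j)^*.
Proof.
have au := pos_def_unit a_pos.
have := mulVmx au => /matrixP E.
transitivity (\sum_k (\sum_i invmx (a z) k i * a z i j) * bbar_low b k z).
  under [RHS]eq_bigr do rewrite mulr_suml.
  rewrite [RHS]exchange_big; apply: eq_bigr => i _; rewrite /b_up mulr_sumr.
  by apply: eq_bigr => k _; rewrite mulrCA mulrA.
rewrite (bigD1 j)//= [X in _ + X]big1 ?addr0.
  by have := E j j; rewrite !mxE eqxx => ->; rewrite mul1r.
by move=> k kj; have := E k j; rewrite !mxE (negbTE kj) => ->; rewrite mul0r.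
Qed.

(** The vector that represents the form [b] with respect to the Hermitian product [a z]: pairing
    with it is beta. *)
Definition b_up_vec : 'rV[cplx R]_n := \row_i bu i.

Lemma hform_b_up eta : hform (a z) eta b_up_vec = lform (b z) eta.
Proof.
apply: eq_bigr => i _; rewrite -[bl i]conjCK -b_up_low rmorph_sum mulr_suml.
by apply: eq_bigr => j _; rewrite mxE rmorphM /= -a_herm mulrAC.
Qed.

Lemma hform_b_upl eta : hform (a z) b_up_vec eta = (lform (b z) eta)^*.
Proof. by rewrite -(hform_conj eta b_up_vec a_herm) hform_b_up. Qed.

Lemma lform_b_up : lform (b z) b_up_vec = nb.
Proof. by rewrite norm_b2_sum; apply: eq_bigr => i _; rewrite mxE. Qed.

Lemma conj_norm_b2 : nb^* = nb.
Proof. by rewrite -lform_b_up -hform_b_up (hform_conj b_up_vec b_up_vec a_herm). Qed.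

Lemma norm_b2_gt0 : b z != 0 -> 0 < nb.
Proof.
move=> b0; rewrite -lform_b_up -hform_b_up; apply: a_pos.
apply: contraNneq b0 => H; apply/eqP/rowP => j; rewrite [RHS]mxE -[LHS]conjCK -b_up_low.
rewrite big1 ?conjC0// => i _; have /rowP/(_ i) := H.
by rewrite !mxE => ->; rewrite mulr0.
Qed.

Lemma norm_b2_eq0 : b z = 0 -> nb = 0.
Proof. by move=> b0; rewrite norm_b2_sum big1// => i _; rewrite b0 mxE mul0r. Qed.

Lemma norm_b2_neq0 : b z != 0 -> nb != 0.
Proof. by move=> /norm_b2_gt0 h; rewrite gt_eqF. Qed.

Lemma sum_conj_b eta : \sum_m (bl m)^* * (eta 0 m)^* = (lform (b z) eta)^*.
Proof.
by rewrite /lform rmorph_sum; apply: eq_bigr => m _; rewrite rmorphM.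
Qed.

Lemma betaE eta : beta b z eta = \sum_i bl i * eta 0 i.
Proof. by []. Qed.

Local Opaque norm_b2 b_up bbar_up beta dhol.

(* The hypothesis on [|beta|^2] and [alpha^2], polarized in [eta]. *)
Hypothesis polar : forall l k m,
  dB l k * (bl m)^* + bl k * dC l m = nb * dA l k m.

(** For b <> 0 it says that every derivative of conj b with respect to z^l is a multiple of conj b
    itself. Contracted with conj [eta] it is condition ii. *)
Definition rank_one := forall l m,
  nb * dC l m = (bl m)^* * \sum_s dC l s * bbu s.

(** [polar] contracted with b^r, which eliminates the derivatives of [a] from condition i. *)
Lemma contract_b_up l m :
  nb * \sum_r bu r * dA l r m = (\sum_r dB l r * bu r) * (bl m)^* + nb * dC l m.
Proof.
rewrite [in RHS]norm_b2_sum [LHS]mulr_sumr !mulr_suml -big_split; apply: eq_bigr => r _ /=.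
by rewrite mulrCA -polar; ring.
Qed.

(** Once the derivatives of [a] are eliminated, both sides of condition i contain the term [u l]
    times conj beta; cancelling it leaves condition ii. *)
Lemma cond_i_ii eta : b z != 0 -> cond_i a b z eta <-> cond_ii a b z eta.
Proof.
move=> /norm_b2_neq0 nb0.
set u := fun l => \sum_r dB l r * bu r.
set k := fun l => \sum_s dC l s * bbu s.
have E1 l : nb * (\sum_(r < n) \sum_(m < n) bu r * dA l r m * (eta 0 m)^*)
   = u l * (beta b z eta)^* + nb * (\sum_(m < n) dC l m * (eta 0 m)^*).
  rewrite exchange_big /= mulr_sumr -sum_conj_b !mulr_sumr -big_split.
  apply: eq_bigr => m _ /=.
  by rewrite -mulr_suml [LHS]mulrA contract_b_up mulrDl; congr (_ + _); rewrite mulrA.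
have E2 l : \sum_(m < n) \sum_(r < n) bbu m * bu r * dA l r m = u l + k l.
  apply: (mulfI nb0).
  transitivity (\sum_m bbu m * (nb * \sum_r bu r * dA l r m)).
    rewrite [LHS]mulr_sumr; apply: eq_bigr => m _; rewrite [RHS]mulrCA; congr (_ * _).
    by rewrite [RHS]mulr_sumr; apply: eq_bigr => r _; rewrite [RHS]mulrA.
  under eq_bigr do rewrite contract_b_up mulrDr.
  rewrite big_split [RHS]mulrDr; congr (_ + _).
    rewrite [in RHS]norm_b2_sum_bar [RHS]mulr_suml; apply: eq_bigr => m _.
    by rewrite mulrCA [RHS]mulrC; congr (_ * _); rewrite mulrC.
  by rewrite [RHS]mulr_sumr; apply: eq_bigr => m _; rewrite mulrCA; congr (_ * _); rewrite mulrC.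
split=> H l; have := H l; rewrite E1 E2 mulrDr -/(k l) [u l * _]mulrC.
  by move=> /addrI.
by move=> ->.
Qed.

Lemma rank_one_ii eta : rank_one -> cond_ii a b z eta.
Proof.
move=> K l; rewrite mulr_sumr [(_)^* * _]mulrC -sum_conj_b mulr_sumr.
by apply: eq_bigr => m _; rewrite mulrA K; ring.
Qed.

(** The difference of the two sides of condition ii is antilinear in [eta], so [linear_form0]
    recovers its coefficients from the vectors with beta <> 0. *)
Lemma ii_rank_one : b z != 0 ->
  (forall eta, beta b z eta != 0 -> cond_ii a b z eta) -> rank_one.
Proof.
move=> b0 H l m; apply/eqP; rewrite -subr_eq0; apply/eqP.
move: m; apply: (linear_form0 b0) => eta /H /(_ l).
move=> E.
transitivity (nb * (\sum_m dC l m * (eta 0 m)^*) - (beta b z eta)^* * \sum_s dC l s * bbu s).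
  rewrite -sum_conj_b [X in _ = X - _]mulr_sumr [X in _ = _ - X]mulr_suml -sumrB.
  by apply: eq_bigr => k _; ring.
by rewrite E subrr.
Qed.

Lemma rank_one_iii eta : b z != 0 -> rank_one -> cond_iii b z eta.
Proof.
move=> /norm_b2_neq0 nb0 K s l; apply: (mulfI nb0).
have := rank_one_ii eta K => /(_ l) H.
by rewrite mulrCA H [RHS]mulrCA K; ring.
Qed.

(** Contract condition iii with the conjugate of b^s. *)
Lemma iii_ii eta : cond_iii b z eta -> cond_ii a b z eta.
Proof.
move=> H l; rewrite norm_b2_sum_bar mulr_suml mulr_sumr; apply: eq_bigr => s _.
by rewrite mulrAC -[(bl s)^*]/(bbar_low b s z) H; ring.
Qed.

(** Contracting [Na] with [b] turns the inverse matrix into [bbar_up]; then [polar], contracted with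
    [bbar_up], trades the derivatives of [a] for those of [b]. *)
Lemma sum_b_Na j eta : nb * \sum_k bl k * Na a k j z eta =
  nb * (\sum_r dB j r * eta 0 r) + beta b z eta * (\sum_s dC j s * bbu s).
Proof.
have -> : \sum_k bl k * Na a k j z eta = \sum_r eta 0 r * \sum_m bbu m * dA j r m.
  transitivity (\sum_k \sum_m \sum_r bl k * (invmx (a z) m k * dA j r m * eta 0 r)).
    apply: eq_bigr => k _; rewrite /Na mulr_sumr; apply: eq_bigr => m _.
    by rewrite mulr_sumr.
  rewrite exchange_big /=; under eq_bigr do rewrite exchange_big /=.
  rewrite exchange_big /=; apply: eq_bigr => r _; rewrite mulr_sumr; apply: eq_bigr => m _.
  rewrite bbar_up_sum mulr_suml mulr_sumr; apply: eq_bigr => k _; ring.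
rewrite betaE mulr_sumr [X in _ = X + _]mulr_sumr [X in _ = _ + X]mulr_suml -big_split.
apply: eq_bigr => r _ /=.
have E : nb * (\sum_m bbu m * dA j r m) = nb * dB j r + bl r * \sum_s dC j s * bbu s.
  rewrite [X in _ = X * _ + _]norm_b2_sum_bar [X in _ = X + _]mulr_suml.
  rewrite [X in _ = _ + X]mulr_sumr [LHS]mulr_sumr -big_split.
  by apply: eq_bigr => m _ /=; rewrite mulrCA -polar; ring.
by rewrite [LHS]mulrCA E; ring.
Qed.

(** The factor 2 in condition iv cancels the one half in [Ga]. After [sum_b_Na] the terms with
    derivatives of [b] disappear, and what is left is beta times the defect of condition ii
    contracted with [eta]. *)
Lemma cond_iv_ii_sum eta : nb * (
  (beta b z eta)^* *
    ((\sum_(i < n) \sum_(l < n) dB l i * eta 0 i * eta 0 l)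
     - 2 * \sum_(l < n) bl l * Ga a l z eta)
  + beta b z eta * (\sum_(m < n) \sum_(l < n) dC l m * (eta 0 m)^* * eta 0 l)) =
  beta b z eta * \sum_l eta 0 l * (nb * (\sum_m dC l m * (eta 0 m)^*) -
     (beta b z eta)^* * \sum_s dC l s * bbu s).
Proof.
have -> : \sum_(i < n) \sum_(l < n) dB l i * eta 0 i * eta 0 l =
    \sum_l eta 0 l * \sum_r dB l r * eta 0 r.
  rewrite exchange_big; apply: eq_bigr => l _; rewrite mulr_sumr.
  by apply: eq_bigr => i _; rewrite mulrC.
have -> : 2 * \sum_(l < n) bl l * Ga a l z eta =
    \sum_l eta 0 l * \sum_k bl k * Na a k l z eta.
  transitivity (\sum_k \sum_l bl k * Na a k l z eta * eta 0 l).
    rewrite mulr_sumr; apply: eq_bigr => k _.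
    transitivity ((2 * 2^-1) * (bl k * \sum_l Na a k l z eta * eta 0 l)); first by rewrite /Ga; ring.
    by rewrite mulfV ?pnatr_eq0// mul1r mulr_sumr; apply: eq_bigr => l _; rewrite [LHS]mulrA.
  rewrite exchange_big; apply: eq_bigr => l _; rewrite mulr_sumr.
  by apply: eq_bigr => k _; rewrite mulrC.
have -> : \sum_(m < n) \sum_(l < n) dC l m * (eta 0 m)^* * eta 0 l =
    \sum_l eta 0 l * \sum_m dC l m * (eta 0 m)^*.
  rewrite exchange_big; apply: eq_bigr => l _; rewrite mulr_sumr.
  by apply: eq_bigr => i _; rewrite mulrC.
have alg (v N B k C be cbe e : cplx R) : v * N = v * B + be * k ->
    v * (cbe * (e * B - e * N) + be * (e * C)) = be * (e * (v * C - cbe * k)).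
  move=> E; transitivity (cbe * e * (v * B - v * N) + v * (be * (e * C))); first by ring.
  by rewrite E; ring.
transitivity (\sum_l nb * ((beta b z eta)^* * (eta 0 l * (\sum_r dB l r * eta 0 r) -
     eta 0 l * \sum_k bl k * Na a k l z eta) +
     beta b z eta * (eta 0 l * \sum_m dC l m * (eta 0 m)^*))).
  by rewrite -mulr_sumr; congr (_ * _); rewrite big_split /= -!mulr_sumr sumrB.
rewrite mulr_sumr; apply: eq_bigr => l _; exact/alg/sum_b_Na.
Qed.

Lemma ii_iv eta : b z != 0 -> cond_ii a b z eta -> cond_iv a b z eta.
Proof.
move=> /norm_b2_neq0 nb0 H; apply: (mulfI nb0); rewrite cond_iv_ii_sum mulr0.
rewrite big1 ?mulr0// => l _; have := H l => ->.
by rewrite subrr mulr0.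
Qed.

(** Condition iv is one scalar equation per [eta]. Divided by beta it is the vanishing of a
    sesquilinear form on the diagonal, so its matrix vanishes. *)
Lemma iv_rank_one : b z != 0 ->
  (forall eta, beta b z eta != 0 -> cond_iv a b z eta) -> rank_one.
Proof.
move=> b0 H.
pose h : 'M[cplx R]_n := \matrix_(l, m) (nb * dC l m - (bl m)^* * \sum_s dC l s * bbu s).
suff h0 : h = 0.
  move=> l m; apply/eqP; rewrite -subr_eq0; apply/eqP.
  by have /matrixP/(_ l m) := h0; rewrite !mxE.
apply: (sesquilinear_dense0 b0) => eta bn0; have := H eta bn0; rewrite /cond_iv => E.
have := cond_iv_ii_sum eta; rewrite E mulr0 => /esym/eqP.
rewrite mulf_eq0 (negbTE bn0) /= => /eqP <-.
apply: eq_bigr => l _; rewrite mulr_sumr -sum_conj_b mulr_suml -sumrB mulr_sumr.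
by apply: eq_bigr => m _; rewrite mxE; ring.
Qed.

(** This is delta_j |beta|^2 = 0: the first bracket is delta_j beta, and the last sum is the
    derivative of conj beta. *)
Lemma dbeta_Na j eta : b z != 0 -> rank_one ->
  (\sum_r dB j r * eta 0 r - \sum_k bl k * Na a k j z eta) * (beta b z eta)^*
    + beta b z eta * (\sum_m dC j m * (eta 0 m)^*) = 0.
Proof.
move=> /norm_b2_neq0 nb0 K; apply: (mulfI nb0); rewrite mulr0.
have alg (v N B k C be cbe : cplx R) : v * N = v * B + be * k -> v * C = cbe * k ->
    v * ((B - N) * cbe + be * C) = 0.
  move=> E1 E2; transitivity ((v * B - v * N) * cbe + be * (v * C)); first by ring.
  by rewrite E1 E2; ring.
apply: alg (sum_b_Na j eta) _; exact: (rank_one_ii eta K j).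
Qed.

End PointwiseConditions.

(** * Derivatives of alpha and beta *)

Section RealValued.
Variables (R : realType) (E : normedModType (cplx R)).

(** Near [x] the imaginary part of [f] is 0, so the imaginary parts of p + q and i (p - q) vanish;
    together they force q = conj p. *)
Lemma wirt_real (r : E -> R) (f : E -> cplx R) u x p q :
  (\forall y \near x, f y = real_cplx (r y)) -> wirt u f x p q ->
  q = p^* /\
  [/\ wirt u (fun y => real_cplx (r y)) x p q,
   is_derive (0 : R) 1 (fun t => r (real_line x u t)) (re (p + q)) &
   is_derive (0 : R) 1 (fun t => r (real_line x (iunit R *: u) t)) (re (iunit R * (p - q)))].
Proof.
move=> fr /(wirt_near fr) h; have [[h1 h2] [h3 h4]] := h.
have z1 : im (p + q) = 0 by have [_ <-] := h2; exact: (derive_cst (0 : R)).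
have z2 : im (iunit R * (p - q)) = 0 by have [_ <-] := h4; exact: (derive_cst (0 : R)).
split; last by split.
move: z1 z2; rewrite imD imM /= mul0r mul1r add0r reD => z1 z2.
have reN : re (- q) = - re q by case: (q).
by apply: cplxP; rewrite ?re_conj ?im_conj; lra.
Qed.

(** The bridge from a vanishing (1,0) derivative of a real function to stationarity along the two
    real lines in directions [u] and [i u]. *)
Lemma wirt_real0 (r : E -> R) (f : E -> cplx R) u x q :
  (\forall y \near x, f y = real_cplx (r y)) -> wirt u f x 0 q ->
  is_derive (0 : R) 1 (fun t => r (real_line x u t)) 0 /\
  is_derive (0 : R) 1 (fun t => r (real_line x (iunit R *: u) t)) 0.
Proof.
move=> fr /(wirt_real fr)[-> []] _; rewrite conjC0 addr0 subr0 mulr0; by split.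
Qed.

End RealValued.

(** * Derivatives of alpha^2 and |beta|^2 in one chart *)

Section ChartCalculus.
Variables (R : realType) (n : nat).
Local Notation V := 'rV[cplx R]_n.
Variables (a : V -> 'M[cplx R]_n) (b : V -> V) (U : set V).
Hypothesis U_open : open U.
Hypothesis a_smooth : forall i j, csmooth_on U (fun z => a z i j).
Hypothesis b_smooth : forall i, csmooth_on U (fun z => b z 0 i).
Hypothesis a_herm : forall z, U z -> forall i j, a z i j = (a z j i)^*.
Hypothesis a_pos : forall z, U z -> pos_def (a z).
Implicit Types z eta v w : V.

Lemma real_cplx_re_ge0 (x : cplx R) : 0 <= x -> real_cplx (re x) = x.
Proof. by rewrite le_eqVlt => /orP[/eqP <-//|/gt0_cplx[<-]]. Qed.

Lemma hform_ge0 z eta : U z -> 0 <= hform (a z) eta eta.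
Proof.
move=> Uz; have [->|e0] := eqVneq eta 0; first by rewrite hform0l.
exact/ltW/a_pos.
Qed.

Lemma alpha2E z eta : U z -> real_cplx (alpha a z eta ^+ 2) = hform (a z) eta eta.
Proof.
move=> /hform_ge0 - /(_ eta) h; rewrite /alpha sqr_sqrtr.
  exact: real_cplx_re_ge0.
by rewrite -ler_real_cplx real_cplx_re_ge0//; exact: h.
Qed.

Lemma abs_beta2E z eta :
  real_cplx (abs_beta b z eta ^+ 2) = beta b z eta * (beta b z eta)^*.
Proof. by rewrite -normCK /abs_beta !expr2 real_cplxM real_cplx_re_ge0. Qed.

Lemma alpha_ge0 z eta : 0 <= alpha a z eta.
Proof. exact: sqrtr_ge0. Qed.

Lemma abs_beta_ge0 z eta : 0 <= abs_beta b z eta.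
Proof. by rewrite -ler_real_cplx /abs_beta real_cplx_re_ge0 ?normr_ge0//; exact: normr_ge0. Qed.

Lemma near_fst (A : set V) z eta : open A -> A z -> \forall y \near (z, eta), A y.1.
Proof.
move=> oA Az; have h : nbhs z A := open_near oA Az.
exact: (@cvg_fst _ _ (nbhs z) (nbhs eta) _ A h).
Qed.

Lemma alpha2_near z eta : U z ->
  \forall y \near (z, eta), hform (a y.1) y.2 y.2 = real_cplx (alpha a y.1 y.2 ^+ 2).
Proof. by move=> Uz; apply: filterS (near_fst eta U_open Uz) => y /alpha2E ->. Qed.

Lemma wirt_beta z eta v w : U z ->
  wirt (v, w) (fun y : V * V => beta b y.1 y.2) (z, eta)
    (\sum_i (chol v (fun z => b z 0 i) z * eta 0 i + b z 0 i * w 0 i))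
    (\sum_i cbar v (fun z => b z 0 i) z * eta 0 i).
Proof.
move=> Uz; apply: wirt_sum => i.
have h := wirtM (wirt_fst w eta (csmooth_wirt v (b_smooth i) Uz))
  (wirt_snd v z (wirt_coord w eta i)).
by apply: wirt_eq h; rewrite /= ?mulr0 ?addr0.
Qed.

Lemma wirt_beta2 z eta v w : U z ->
  wirt (v, w) (fun y : V * V => real_cplx (abs_beta b y.1 y.2 ^+ 2)) (z, eta)
    ((\sum_i (chol v (fun z => b z 0 i) z * eta 0 i + b z 0 i * w 0 i)) * (beta b z eta)^*
      + beta b z eta * \sum_i (cbar v (fun z => b z 0 i) z)^* * (eta 0 i)^*)
    ((\sum_i cbar v (fun z => b z 0 i) z * eta 0 i) * (beta b z eta)^* +
      beta b z eta * (\sum_i (chol v (fun z => b z 0 i) z * eta 0 i + b z 0 i * w 0 i))^*).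
Proof.
move=> Uz; have h := wirt_beta eta v w Uz.
have -> : (fun y : V * V => real_cplx (abs_beta b y.1 y.2 ^+ 2)) =
    (fun y => beta b y.1 y.2 * (beta b y.1 y.2)^*).
  by apply/funext => y; rewrite abs_beta2E.
apply: wirt_eq (wirtM h (wirt_conj h)) => //=.
congr (_ + _ * _); rewrite rmorph_sum; apply: eq_bigr => i _; exact: rmorphM.
Qed.

(** Only the (1,0) part is made explicit; the other is its conjugate by [wirt_real]. *)
Lemma wirt_alpha2 z eta v w : U z ->
  exists q, wirt (v, w) (fun y : V * V => hform (a y.1) y.2 y.2) (z, eta)
    (\sum_i \sum_j (chol v (fun z => a z i j) z * eta 0 i + a z i j * w 0 i) * (eta 0 j)^*) q.
Proof.
move=> Uz; eexists; apply: wirt_sum => i; apply: wirt_sum => j.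
have h := wirtM (wirtM (wirt_fst w eta (csmooth_wirt v (a_smooth i j) Uz))
   (wirt_snd v z (wirt_coord w eta i))) (wirt_conj (wirt_snd v z (wirt_coord w eta j))).
by apply: wirt_eq h; rewrite /= ?conjC0 ?mulr0 ?addr0; reflexivity.
Qed.

Lemma dhol_bbar l m z : U z ->
  dhol l (bbar_low b m) z = (cbar (delta_mx 0 l) (fun z => b z 0 m) z)^*.
Proof.
by move=> Uz; have [] := wirt_val (wirt_conj (csmooth_wirt (delta_mx 0 l) (b_smooth m) Uz)).
Qed.

Lemma dhol_alpha2 z eta l : U z ->
  dhol l (fun w => real_cplx (alpha a w eta ^+ 2)) z =
    \sum_i \sum_j dhol l (fun z => a z i j) z * eta 0 i * (eta 0 j)^*.
Proof.
move=> Uz; have [q /(wirt_real (alpha2_near eta Uz))[_ [/wirt_val[h _] _ _]]] :=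
   wirt_alpha2 eta (delta_mx 0 l) 0 Uz.
rewrite [LHS](@chol_fst R V V (fun y => real_cplx (alpha a y.1 y.2 ^+ 2)) (delta_mx 0 l) z eta) h.
by apply: eq_bigr => i _; apply: eq_bigr => j _; rewrite [X in _ + _ * X]mxE mulr0 addr0.
Qed.

Lemma dhol_beta2 z eta l : U z ->
  dhol l (fun w => real_cplx (abs_beta b w eta ^+ 2)) z =
    (\sum_i dhol l (fun z => b z 0 i) z * eta 0 i) * (beta b z eta)^*
      + beta b z eta * \sum_i dhol l (bbar_low b i) z * (eta 0 i)^*.
Proof.
move=> Uz; have [h _] := wirt_val (wirt_beta2 eta (delta_mx 0 l) 0 Uz).
rewrite [LHS](@chol_fst R V V (fun y => real_cplx (abs_beta b y.1 y.2 ^+ 2)) (delta_mx 0 l) z eta) h.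
congr (_ * _ + _ * _).
  by apply: eq_bigr => i _; rewrite [X in _ + _ * X]mxE mulr0 addr0.
by apply: eq_bigr => i _; rewrite dhol_bbar.
Qed.

(** Where [b] vanishes, each term has a factor [b] or [norm_b2]. Elsewhere the difference of the two
    sides is a sesquilinear form that vanishes on the diagonal off the hyperplane beta = 0. *)
Lemma polarize z : U z ->
  (forall eta, beta b z eta != 0 -> beta_alpha_proportional a b z eta) ->
  forall l k m, dhol l (fun w => b w 0 k) z * (b z 0 m)^* + b z 0 k * dhol l (bbar_low b m) z
    = norm_b2 a b z * dhol l (fun w => a w k m) z.
Proof.
move=> Uz H l k m; have [b0|b0] := eqVneq (b z) 0.
  by rewrite (norm_b2_eq0 a b0) b0 !mxE conjC0 mulr0 !mul0r addr0.
pose h : 'M[cplx R]_n := \matrix_(k, m) (dhol l (fun w => b w 0 k) z * (b z 0 m)^*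
  + b z 0 k * dhol l (bbar_low b m) z - norm_b2 a b z * dhol l (fun w => a w k m) z).
suff h0 : h = 0.
  by have /matrixP/(_ k m) := h0; rewrite !mxE => /eqP; rewrite subr_eq0 => /eqP.
apply: (sesquilinear_dense0 b0) => eta /H /(_ l); rewrite dhol_alpha2// dhol_beta2// => E.
transitivity ((\sum_i dhol l (fun z => b z 0 i) z * eta 0 i) * (beta b z eta)^*
      + beta b z eta * (\sum_i dhol l (bbar_low b i) z * (eta 0 i)^*) -
   norm_b2 a b z * \sum_i \sum_j dhol l (fun z => a z i j) z * eta 0 i * (eta 0 j)^*); last first.
  by rewrite E subrr.
rewrite -sum_conj_b betaE [X in _ = X + _ - _]big_distrlr [X in _ = _ + X - _]big_distrlr.
rewrite [X in _ = _ - X]mulr_sumr -big_split -sumrB.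
apply: eq_bigr => i _; rewrite [X in _ = _ - X]mulr_sumr -big_split -sumrB.
have alg (p q r s v A e e' : cplx R) :
    (p * q + r * s - v * A) * e * e' = p * e * (q * e') + r * e * (s * e') - v * (A * e * e') by ring.
by apply: eq_bigr => j _; rewrite mxE; exact: alg.
Qed.

Definition Na_vec j z eta : V := \row_k Na a k j z eta.

(** Lowering the index of [Na] with [a] cancels the inverse matrix; this compatibility with the
    metric is why delta_j annihilates alpha^2. *)
Lemma hform_Na j z eta : U z ->
  hform (a z) (Na_vec j z eta) eta =
    \sum_i \sum_m dhol j (fun z => a z i m) z * eta 0 i * (eta 0 m)^*.
Proof.
move=> Uz; rewrite /hform exchange_big [RHS]exchange_big; apply: eq_bigr => m _ /=.
rewrite -!mulr_suml; congr (_ * _).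
have /matrixP E := mulVmx (pos_def_unit (a_pos Uz)).
transitivity (\sum_k (\sum_i invmx (a z) k i * a z i m) *
    \sum_l dhol j (fun w => a w l k) z * eta 0 l).
  under [RHS]eq_bigr do rewrite mulr_suml.
  rewrite [RHS]exchange_big; apply: eq_bigr => i _ /=.
  rewrite mxE /Na mulr_sumr; apply: eq_bigr => k _.
  rewrite !mulr_sumr; apply: eq_bigr => l _; ring.
rewrite (bigD1 m)//= [X in _ + X]big1 ?addr0.
  by have := E m m; rewrite !mxE eqxx => ->; rewrite mul1r.
by move=> k km; have := E k m; rewrite !mxE (negbTE km) => ->; rewrite mul0r.
Qed.

(** The value of delta_j at (z, eta), frozen as a constant direction: a first derivative at that
    point sees nothing more of the field. *)
Definition hdir j z eta : V * V := (delta_mx 0 j, - Na_vec j z eta).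

Lemma hdir_alpha2 j z eta : U z ->
  is_derive (0 : R) 1 (fun t => (fun y : V * V => alpha a y.1 y.2 ^+ 2)
     (real_line (z, eta) (hdir j z eta) t)) 0 /\
  is_derive (0 : R) 1 (fun t => (fun y : V * V => alpha a y.1 y.2 ^+ 2)
     (real_line (z, eta) (iunit R *: hdir j z eta) t)) 0.
Proof.
move=> Uz; have [q h] := wirt_alpha2 eta (delta_mx 0 j) (- Na_vec j z eta) Uz.
apply: (@wirt_real0 R _ (fun y : V * V => alpha a y.1 y.2 ^+ 2) _ _ _ q (alpha2_near eta Uz)).
apply: wirt_eq h => //.
transitivity (\sum_i \sum_m dhol j (fun z => a z i m) z * eta 0 i * (eta 0 m)^*
   - hform (a z) (Na_vec j z eta) eta); last by rewrite hform_Na// subrr.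
rewrite -sumrB; apply: eq_bigr => i _; rewrite -sumrB; apply: eq_bigr => m _.
by rewrite [X in _ + _ * X]mxE mulrN mulrBl.
Qed.

Lemma hdir_beta2 j z eta : U z ->
  (forall l k m, dhol l (fun w => b w 0 k) z * (b z 0 m)^* + b z 0 k * dhol l (bbar_low b m) z
    = norm_b2 a b z * dhol l (fun w => a w k m) z) ->
  (b z != 0 -> rank_one a b z) ->
  is_derive (0 : R) 1 (fun t => (fun y : V * V => abs_beta b y.1 y.2 ^+ 2)
     (real_line (z, eta) (hdir j z eta) t)) 0 /\
  is_derive (0 : R) 1 (fun t => (fun y : V * V => abs_beta b y.1 y.2 ^+ 2)
     (real_line (z, eta) (iunit R *: hdir j z eta) t)) 0.
Proof.
move=> Uz polar K; have h := wirt_beta2 eta (delta_mx 0 j) (- Na_vec j z eta) Uz.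
have nr : \forall y \near (z, eta), real_cplx (abs_beta b y.1 y.2 ^+ 2) =
   real_cplx ((fun y : V * V => abs_beta b y.1 y.2 ^+ 2) y) by exact: filterE.
apply: (wirt_real0 nr); apply: wirt_eq h; last reflexivity.
(* Where [b] vanishes, beta is 0 as well, and the product rule for beta times conj beta gives 0 in
   every direction. *)
have [b0|b0] := eqVneq (b z) 0.
  have -> : beta b z eta = 0 by apply: big1 => i _; rewrite b0 mxE mul0r.
  by rewrite conjC0 mulr0 mul0r addr0.
rewrite -[RHS](dbeta_Na (a_herm Uz) (a_pos Uz) polar j eta b0 (K b0)).
congr (_ * _ + _ * _).
  by rewrite -sumrB; apply: eq_bigr => i _; rewrite !mxE mulrN.
by apply: eq_bigr => i _; rewrite dhol_bbar.
Qed.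

End ChartCalculus.

(** * Constancy of the energy along horizontal directions *)

Section ContinuousSums.
Variables (R : realType) (E : normedModType (cplx R)).

Lemma continuous_sum (I : finType) (f : I -> E -> cplx R) x :
  (forall i, {for x, continuous (f i)}) -> {for x, continuous (fun y => \sum_i f i y)}.
Proof.
move=> H; elim: (index_enum I) => [|i s IH].
  have -> : (fun y => \sum_(j <- [::]) f j y) = (fun=> 0 : cplx R).
    by apply/funext => y; rewrite big_nil.
  exact: cvg_cst.
have -> : (fun y => \sum_(j <- i :: s) f j y) = (fun y => f i y + \sum_(j <- s) f j y).
  by apply/funext => y; rewrite big_cons.
exact: (cvgD (H i) IH).
Qed.

Lemma stationary2 (A : set E) (f : E -> R) x u v (p q : R -> R) :
  open A -> smooth_on A f -> A x -> p 0 = 0 -> q 0 = 0 ->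
  is_derive (0 : R) 1 p 0 -> is_derive (0 : R) 1 q 0 ->
  is_derive (0 : R) 1 (fun t => f (real_line (real_line x u (p t)) v (q t))) 0.
Proof.
move=> oA sf Ax p0 q0 Dp Dq.
have := @chain_rule2 R E A f x u v p q 0 0 (open_near oA Ax)
  (fun y Ay => @smooth_derivable R E A f [::] u y sf Ay)
  (fun y Ay => @smooth_derivable R E A f [::] v y sf Ay)
  (@smooth_continuous R E A f [:: u] x sf Ax)
  (@smooth_continuous R E A f [:: v] x sf Ax) p0 q0 Dp Dq.
by rewrite !mul0r addr0.
Qed.

End ContinuousSums.

Lemma is_derive_sqrt0 (R : realType) (f : R -> R) :
  is_derive (0 : R) 1 f 0 -> 0 < f 0 -> is_derive (0 : R) 1 (fun t => Num.sqrt (f t)) 0.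
Proof.
move=> Df f0; rewrite -[X in is_derive _ _ _ X](mulr0 (2 * Num.sqrt (f 0))^-1).
by apply: is_derive1_comp Df; exact: is_derive1_sqrt.
Qed.

(** * Comparison of the energy with its restriction to one fibre *)

Section AlphaBetaFunctions.
Variables (R : realType) (n : nat).
Local Notation V := 'rV[cplx R]_n.
Variables (a : V -> 'M[cplx R]_n) (b : V -> V) (U : set V).
Hypothesis U_open : open U.
Hypothesis a_smooth : forall i j, csmooth_on U (fun z => a z i j).
Hypothesis b_smooth : forall i, csmooth_on U (fun z => b z 0 i).
Hypothesis a_herm : forall z, U z -> forall i j, a z i j = (a z j i)^*.
Hypothesis a_pos : forall z, U z -> pos_def (a z).
Implicit Types z eta v w : V.
Implicit Types y : V * V.

Variable excl : bool.
Variable F : V -> V -> R.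
Variable phi : R -> R -> R.

(** For [U := chart_img c] this is [slit (fdom excl b) c] unfolded, so that the analysis can be done
    in a coordinate space without the manifold. *)
Definition chart_slit : set (V * V) :=
  [set y | (U y.1 /\ (excl -> beta b y.1 y.2 != 0)) /\ y.2 != 0].

Definition energy y := F y.1 y.2 ^+ 2.

Hypothesis F_phi : forall y, chart_slit y ->
  F y.1 y.2 = phi (alpha a y.1 y.2) (abs_beta b y.1 y.2).
Hypothesis energy_smooth : smooth_on chart_slit energy.

Lemma continuous_fst_comp (f : V -> cplx R) y : {for y.1, continuous f} ->
  {for y, continuous (fun y : V * V => f y.1)}.
Proof.
case: y => z eta h.
have h1 : (fst : V * V -> V) y @[y --> (z, eta)] --> z.
  by move=> A; exact: (@cvg_fst _ _ (nbhs z) (nbhs eta) _ A).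
exact: (cvg_comp _ _ h1 h).
Qed.

Lemma continuous_snd_comp (f : V -> cplx R) y : {for y.2, continuous f} ->
  {for y, continuous (fun y : V * V => f y.2)}.
Proof.
case: y => z eta h.
have h1 : (snd : V * V -> V) y @[y --> (z, eta)] --> eta.
  by move=> A; exact: (@cvg_snd _ _ (nbhs z) (nbhs eta) _ A).
exact: (cvg_comp _ _ h1 h).
Qed.

Lemma continuous_coord (k : 'I_n) eta : {for eta, continuous (fun eta : V => eta 0 k)}.
Proof. exact: (@coord_continuous (cplx R) 1 n 0 k). Qed.

Lemma continuous_beta y : U y.1 -> {for y, continuous (fun y => beta b y.1 y.2)}.
Proof.
move=> Uy; apply: continuous_sum => i; apply: cvgM.
  by apply: (@continuous_fst_comp (fun z => b z 0 i)); exact: (csmooth_continuous (b_smooth i)).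
by apply: (@continuous_snd_comp (fun z => z 0 i)); exact: continuous_coord.
Qed.

Lemma near_U y : U y.1 -> \forall y' \near y, U y'.1.
Proof. by case: y => z eta; exact: near_fst. Qed.

Lemma near_beta_neq0 y : U y.1 -> beta b y.1 y.2 != 0 -> \forall y' \near y, beta b y'.1 y'.2 != 0.
Proof. by move=> /continuous_beta h b0; apply: (cvgr_neq0 _ h b0). Qed.

Lemma chart_slit_open : open chart_slit.
Proof.
rewrite openE => y [[Uy by0] y0].
have h1 : \forall y' \near y, U (y' : V * V).1 /\ (excl -> beta b y'.1 y'.2 != 0).
  move: by0; case: excl => by0.
    by apply: filterS2 (near_U Uy) (near_beta_neq0 Uy (by0 isT)) => ? ? ?; split.
  by apply: filterS (near_U Uy) => ? ?; split.
have [k yk] : exists k, y.2 0 k != 0.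
  apply: contrapT => H; move/eqP: y0; apply; apply/rowP => k; rewrite mxE.
  by apply/eqP/negPn/negP => h; apply: H; exists k.
have h2 : \forall y' \near y, (y' : V * V).2 0 k != 0.
  by apply: (cvgr_neq0 _ (@continuous_snd_comp (fun z => z 0 k) y _) yk); exact: continuous_coord.
apply: filterS2 h1 h2 => y' H1 H2; split=> //.
by apply: contraNneq H2 => ->; rewrite mxE.
Qed.

Lemma beta_scale z eta c : beta b z (c *: eta) = c * beta b z eta.
Proof. exact: lformZ. Qed.

Lemma abs_beta_eq z eta z' eta' :
  abs_beta b z eta ^+ 2 = abs_beta b z' eta' ^+ 2 -> abs_beta b z eta = abs_beta b z' eta'.
Proof. by move=> /eqP; rewrite eqrXn2 ?abs_beta_ge0// => /eqP. Qed.

Lemma alpha_eq z eta z' eta' :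
  alpha a z eta ^+ 2 = alpha a z' eta' ^+ 2 -> alpha a z eta = alpha a z' eta'.
Proof. by move=> /eqP; rewrite eqrXn2 ?alpha_ge0// => /eqP. Qed.

(* Along the line, the energy equals its restriction to the single fibre over
   [z], evaluated at a point which is stationary at [t = 0]: this replaces the
   chain rule for [phi], about which no regularity is known. *)
Lemma energy_stationary z eta (W : V * V) u v (p q : R -> R) :
  chart_slit (z, eta) -> p 0 = 0 -> q 0 = 0 ->
  is_derive (0 : R) 1 p 0 -> is_derive (0 : R) 1 q 0 ->
  (\forall t \near (0 : R),
     let y := real_line (z, eta) W t in
     let eta' := real_line (real_line eta u (p t)) v (q t) in
     alpha a y.1 y.2 ^+ 2 = alpha a z eta' ^+ 2 /\
     abs_beta b y.1 y.2 ^+ 2 = abs_beta b z eta' ^+ 2) ->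
  is_derive (0 : R) 1 (fun t => energy (real_line (z, eta) W t)) 0.
Proof.
move=> Sy p0 q0 Dp Dq H.
have S' := open_near chart_slit_open Sy.
have D := stationary2 (0, u) (0, v) chart_slit_open energy_smooth Sy p0 q0 Dp Dq.
apply: near_eq_is_derive D.
have S1 := near_real_line W S'.
have S2 : \forall t \near (0 : R),
    chart_slit (real_line (real_line (z, eta) (0, u) (p t)) (0, v) (q t)).
  have cont (r : R -> R) : r 0 = 0 -> is_derive (0 : R) 1 r 0 -> r t @[t --> (0 : R)] --> (0 : R).
    move=> r0 [Dr _]; rewrite -[X in _ --> X]r0.
    exact/differentiable_continuous/derivable1_diffP.
  exact: (@cvg_real_line2 R _ R _ (nbhs_filter (0 : R)) (z, eta) (0, u) (0, v) p q
    (cont p p0 Dp) (cont q q0 Dq) _ S').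
apply: filterS3 S1 S2 H => t s1 s2 [h1 h2].
move: s2; rewrite (real_line_snd z eta u) (real_line_snd z _ v) => s2.
congr (_ ^+ 2); apply: etrans (F_phi s2) _; apply: etrans _ (esym (F_phi s1)).
by rewrite (alpha_eq h1) (abs_beta_eq h2).
Qed.

End AlphaBetaFunctions.

(** The displacements passed to [energy_stationary2] have this shape: a scaling factor, the square
    root of a ratio equal to 1 at 0, minus 1. *)
Lemma sqrt_stationary (R : realType) (f : R -> R) :
  is_derive (0 : R) 1 f 0 -> f 0 = 1 ->
  [/\ Num.sqrt (f 0) - 1 = 0,
      is_derive (0 : R) 1 (fun t => Num.sqrt (f t) - 1) 0 &
      \forall t \near (0 : R), 0 < f t].
Proof.
move=> Df f1; have f0 : 0 < f 0 by rewrite f1 ltr01.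
split; first by rewrite f1 sqrtr1 subrr.
  have := is_deriveB (is_derive_sqrt0 Df f0) (is_derive_cst (1 : R) (0 : R) (1 : R)).
  by rewrite subr0.
have [Dfd _] := Df.
have cont : f t @[t --> (0 : R)] --> f 0.
  exact/differentiable_continuous/derivable1_diffP.
by apply: (cvgr_gt _ cont).
Qed.

Section StationaryEnergy.
Variables (R : realType) (n : nat).
Local Notation V := 'rV[cplx R]_n.
Variables (a : V -> 'M[cplx R]_n) (b : V -> V) (U : set V).
Hypothesis U_open : open U.
Hypothesis a_smooth : forall i j, csmooth_on U (fun z => a z i j).
Hypothesis b_smooth : forall i, csmooth_on U (fun z => b z 0 i).
Hypothesis a_herm : forall z, U z -> forall i j, a z i j = (a z j i)^*.
Hypothesis a_pos : forall z, U z -> pos_def (a z).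
Variable excl : bool.
Variable F : V -> V -> R.
Variable phi : R -> R -> R.
Local Notation S := (chart_slit b U excl).
Hypothesis F_phi : forall y, S y ->
  F y.1 y.2 = phi (alpha a y.1 y.2) (abs_beta b y.1 y.2).
Hypothesis energy_smooth : smooth_on S (energy F).
Implicit Types z eta v w : V.
Implicit Types y : V * V.

Definition alpha2 y : R := alpha a y.1 y.2 ^+ 2.
Definition beta2 y : R := abs_beta b y.1 y.2 ^+ 2.

Lemma alpha2_hform z eta : U z -> real_cplx (alpha2 (z, eta)) = hform (a z) eta eta.
Proof. exact: alpha2E. Qed.

Lemma beta2E z eta : real_cplx (beta2 (z, eta)) = beta b z eta * (beta b z eta)^*.
Proof. exact: abs_beta2E. Qed.

Lemma alpha2_gt0 z eta : U z -> eta != 0 -> 0 < alpha2 (z, eta).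
Proof.
move=> Uz e0; rewrite -ltr_real_cplx alpha2_hform//; exact: (a_pos Uz e0).
Qed.

Lemma beta2_gt0 z eta : beta b z eta != 0 -> 0 < beta2 (z, eta).
Proof.
move=> b0; rewrite -ltr_real_cplx /beta2 abs_beta2E -normCK exprn_gt0//.
by rewrite normr_gt0.
Qed.

Lemma beta2_ge0 y : 0 <= beta2 y.
Proof. exact: sqr_ge0. Qed.

Lemma alpha2_scale z eta (r : R) : U z ->
  alpha2 (z, real_cplx r *: eta) = r ^+ 2 * alpha2 (z, eta).
Proof.
move=> Uz; apply: real_cplx_inj; rewrite real_cplxM !alpha2_hform//.
by rewrite hformZl hformZr conj_real_cplx mulrA -real_cplxM expr2.
Qed.

Lemma beta2_scale z eta (r : R) :
  beta2 (z, real_cplx r *: eta) = r ^+ 2 * beta2 (z, eta).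
Proof.
apply: real_cplx_inj; rewrite real_cplxM /beta2 !abs_beta2E beta_scale.
by rewrite rmorphM /= conj_real_cplx expr2 real_cplxM; ring.
Qed.

Lemma energy_stationary2 z eta (W : V * V) u v (p q : R -> R) :
  S (z, eta) -> p 0 = 0 -> q 0 = 0 ->
  is_derive (0 : R) 1 p 0 -> is_derive (0 : R) 1 q 0 ->
  (\forall t \near (0 : R),
     alpha2 (real_line (z, eta) W t) = alpha2 (z, real_line (real_line eta u (p t)) v (q t)) /\
     beta2 (real_line (z, eta) W t) = beta2 (z, real_line (real_line eta u (p t)) v (q t))) ->
  is_derive (0 : R) 1 (fun t => energy F (real_line (z, eta) W t)) 0.
Proof.
exact: (@energy_stationary R n a b U U_open b_smooth excl F phi F_phi energy_smooth z eta W u v p q).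
Qed.

Local Opaque alpha2 beta2.

(** When |beta|^2 is a constant multiple of alpha^2 along the line, scaling [eta] by one real factor
    matches both. The factor is the square root of the ratio of alpha^2 at [t] to alpha^2 at 0, and
    the second direction is idle. *)
Lemma stationary_proportional z eta (W : V * V) (rho : R) : S (z, eta) ->
  is_derive (0 : R) 1 (fun t => alpha2 (real_line (z, eta) W t)) 0 ->
  (\forall t \near (0 : R), beta2 (real_line (z, eta) W t) =
      rho * alpha2 (real_line (z, eta) W t)) ->
  is_derive (0 : R) 1 (fun t => energy F (real_line (z, eta) W t)) 0.
Proof.
move=> Sy Da H; have [[Uz _] e0] := Sy; rewrite /= in Uz e0.
have A0 := alpha2_gt0 Uz e0.
have H0 := nbhs_singleton H; rewrite !real_line0 in H0.
pose f t := alpha2 (real_line (z, eta) W t).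
have f00 : f 0 = alpha2 (z, eta) by rewrite /f real_line0.
have f0 : 0 < f 0 by rewrite f00.
have DC : is_derive (0 : R) 1 (fun t => (f 0)^-1 * f t) 0.
  have h := is_derive_comb (f 0)^-1 0 Da Da.
  rewrite mulr0 mulr0 addr0 in h.
  rewrite (_ : (fun t => (f 0)^-1 * f t) = (fun t => (f 0)^-1 * alpha2 (real_line (z, eta) W t) +
     0 * alpha2 (real_line (z, eta) W t))) //.
  by apply/funext => t; rewrite mul0r addr0.
have f1 : (f 0)^-1 * f 0 = 1 by rewrite mulVf// gt_eqF.
have [r0 Dr rpos] := sqrt_stationary DC f1.
apply: (@energy_stationary2 z eta W eta 0 _ (fun=> 0) Sy r0 _ Dr
  (is_derive_cst (0 : R) (0 : R) (1 : R))) => //.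
apply: filterS2 rpos H => t ft Ht; set r := Num.sqrt _.
have -> : real_line (real_line eta eta (r - 1)) 0 0 = real_cplx r *: eta.
  by rewrite real_line0 /real_line -{1}[eta]scale1r -scalerDl real_cplxB
     real_cplx1 addrC subrK.
have rr : r ^+ 2 * f 0 = f t.
  have rE : r ^+ 2 = (f 0)^-1 * f t := sqr_sqrtr (ltW ft).
  have fn0 : f 0 != 0 by rewrite gt_eqF.
  by rewrite rE mulrAC mulVf// mul1r.
rewrite (alpha2_scale _ _ Uz) beta2_scale -f00 rr; split=> //.
by rewrite Ht H0 [RHS]mulrCA -f00 rr.
Qed.

(** The component of [eta] orthogonal to [b_up_vec] for [a z]; where b <> 0 it vanishes exactly on
    the multiples of [b_up_vec]. *)
Definition b_perp z eta : V := eta - (beta b z eta / norm_b2 a b z) *: b_up_vec a b z.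

(** Split [eta] orthogonally as p + q with q along [b_up_vec]. By Pythagoras, on r p + s q the
    square |beta|^2 depends on s alone and alpha^2 = r^2 P + s^2 |beta|^2 / K. So s is fixed by
    |beta|^2 and then r by alpha^2, both being square roots of functions that are positive and
    stationary at t = 0. *)
Lemma stationary_generic z eta (W : V * V) : S (z, eta) -> b z != 0 ->
  beta b z eta != 0 -> b_perp z eta != 0 ->
  is_derive (0 : R) 1 (fun t => alpha2 (real_line (z, eta) W t)) 0 ->
  is_derive (0 : R) 1 (fun t => beta2 (real_line (z, eta) W t)) 0 ->
  is_derive (0 : R) 1 (fun t => energy F (real_line (z, eta) W t)) 0.
Proof.
have combine (P K g0 ft gt : R) : P != 0 -> g0 != 0 ->
    P^-1 * (ft - gt / K) * P + g0^-1 * gt * (g0 / K) = ft.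
  move=> P0 g0n; rewrite mulrAC mulVf// mul1r mulrA [g0^-1 * _ * _]mulrAC mulVf// mul1r.
  exact: subrK.
move=> Sy bz be0 pe0 Da Db; have [[Uz _] e0] := Sy; rewrite /= in Uz e0.
have nb0 := norm_b2_gt0 (a_herm Uz) (a_pos Uz) bz.
have [nbE K0] := gt0_cplx nb0; set K := re _ in nbE K0.
have nbn : norm_b2 a b z != 0 by rewrite gt_eqF.
have [q qE] : exists q, q = (beta b z eta / norm_b2 a b z) *: b_up_vec a b z by eexists.
have [p pE] : exists p, p = b_perp z eta by eexists.
rewrite -pE in pe0.
have pq : eta = p + q by rewrite pE qE /b_perp subrK.
have bq : beta b z q = beta b z eta.
  have bbu : beta b z (b_up_vec a b z) = norm_b2 a b z := lform_b_up a b z.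
  by rewrite qE beta_scale bbu divfK.
have bp : beta b z p = 0.
  have bD : beta b z (p + q) = beta b z p + beta b z q := lformD (b z) p q.
  by rewrite -pq bq in bD; apply: (addIr (beta b z eta)); rewrite add0r -bD.
have hpq : hform (a z) p q = 0.
  by rewrite qE hformZr (hform_b_up b (a_herm Uz) (a_pos Uz)) [lform _ _]bp mulr0.
have P0 := a_pos Uz pe0; rewrite -/(hform _ _ _) in P0.
have [PE P0'] := gt0_cplx P0; set P := re _ in PE P0'.
have B0 := beta2_gt0 be0.
have hqq : hform (a z) q q = real_cplx (beta2 (z, eta) / K).
  rewrite qE hformZl hformZr (hform_b_up b (a_herm Uz) (a_pos Uz)) lform_b_up.
  have -> : real_cplx (beta2 (z, eta) / K) = beta b z eta * (beta b z eta)^* / norm_b2 a b z.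
    rewrite -beta2E.
    apply: (mulIf nbn); rewrite [RHS]divfK// [X in _ * X = _]nbE -real_cplxM divfK//.
    by rewrite gt_eqF.
  rewrite rmorphM fmorphV /= (conj_norm_b2 b (a_herm Uz) (a_pos Uz)).
  move: (beta b z eta) (norm_b2 a b z) nbn => x y y0; by field.
pose f t := alpha2 (real_line (z, eta) W t).
pose g t := beta2 (real_line (z, eta) W t).
have f00 : f 0 = alpha2 (z, eta) by rewrite /f real_line0.
have g00 : g 0 = beta2 (z, eta) by rewrite /g real_line0.
have comb (r s : R) : alpha2 (z, real_cplx r *: p + real_cplx s *: q) =
    r ^+ 2 * P + s ^+ 2 * (g 0 / K).
  apply: real_cplx_inj; rewrite alpha2_hform// !hformDl !hformDr !hformZl !hformZr.
  rewrite -(hform_conj p q (a_herm Uz)) hpq conjC0 !conj_real_cplx hqq PE !mulr0 addr0 add0r.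
  by rewrite g00 real_cplxD !real_cplxM; ring.
have f0E : f 0 = P + g 0 / K.
  by have := comb 1 1; rewrite !scale1r -pq f00 => ->; rewrite !expr1n !mul1r.
have combb (r s : R) : beta2 (z, real_cplx r *: p + real_cplx s *: q) = s ^+ 2 * g 0.
  have bD : beta b z (real_cplx r *: p + real_cplx s *: q) =
     beta b z (real_cplx r *: p) + beta b z (real_cplx s *: q) := lformD (b z) _ _.
  rewrite g00 -beta2_scale; apply: real_cplx_inj; rewrite !beta2E bD !beta_scale.
  by rewrite bp bq mulr0 add0r.
(* The value that r^2 P must take once s^2 has been chosen to match |beta|^2; it equals [P] at t =
   0. *)
pose C t := f t - g t / K.
have DC : is_derive (0 : R) 1 (fun t => P^-1 * C t) 0.
  have h := is_derive_comb P^-1 (- (P^-1 * K^-1)) Da Db.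
  rewrite mulr0 mulr0 addr0 in h.
  rewrite (_ : (fun t => P^-1 * C t) = (fun t => P^-1 * alpha2 (real_line (z, eta) W t) +
     - (P^-1 * K^-1) * beta2 (real_line (z, eta) W t))) //.
  by apply/funext => t; rewrite /C /f /g; ring.
have DB : is_derive (0 : R) 1 (fun t => (g 0)^-1 * g t) 0.
  have h := is_derive_comb (g 0)^-1 0 Db Db.
  rewrite mulr0 mulr0 addr0 in h.
  rewrite (_ : (fun t => (g 0)^-1 * g t) = (fun t => (g 0)^-1 * beta2 (real_line (z, eta) W t) +
     0 * beta2 (real_line (z, eta) W t))) //.
  by apply/funext => t; rewrite mul0r addr0.
have C1 : P^-1 * C 0 = 1 by rewrite /C f0E addrK mulVf// gt_eqF.
have gn0 : g 0 != 0 by rewrite g00 gt_eqF.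
have B1 : (g 0)^-1 * g 0 = 1 by rewrite mulVf.
have [r0 Dr Cpos] := sqrt_stationary DC C1.
have [s0 Ds _] := sqrt_stationary DB B1.
apply: (@energy_stationary2 z eta W p q _ _ Sy r0 s0 Dr Ds).
apply: filterS Cpos => t Ct.
set r := Num.sqrt (P^-1 * C t); set s := Num.sqrt ((g 0)^-1 * g t).
have -> : real_line (real_line eta p (r - 1)) q (s - 1) = real_cplx r *: p + real_cplx s *: q.
  rewrite /real_line !real_cplxB real_cplx1 {1}pq !scalerBl !scale1r.
  by rewrite [p + q]addrC -[q + p + _]addrA [p + _]addrC subrK [q + _]addrC -addrA [q + _]addrC subrK.
have g_ge0 : 0 <= (g 0)^-1 * g t by rewrite mulr_ge0 ?invr_ge0 ?beta2_ge0.
have rE : r ^+ 2 = P^-1 * C t by rewrite sqr_sqrtr// ltW.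
have sE : s ^+ 2 = (g 0)^-1 * g t by rewrite sqr_sqrtr.
have Pn0 : P != 0 by rewrite gt_eqF.
have gg : (g 0)^-1 * g t * g 0 = g t by rewrite mulrAC mulVf ?mul1r.
split.
  apply: esym; apply: etrans (comb r s) _.
  rewrite rE sE; exact: (combine P K (g 0) (f t) (g t) Pn0 gn0).
apply: esym; apply: etrans (combb r s) _.
rewrite sE; exact: gg.
Qed.

Local Notation Lc := (fun y => real_cplx (energy F y)).

Lemma chol_energy0 (y W : V * V) :
  is_derive (0 : R) 1 (fun t => energy F (real_line y W t)) 0 ->
  is_derive (0 : R) 1 (fun t => energy F (real_line y (iunit R *: W) t)) 0 ->
  chol W Lc y = 0.
Proof.
move=> /has_cder_real/has_cder_val h1 /has_cder_real/has_cder_val h2.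
by rewrite /chol h1 h2 real_cplx0 mulr0 subr0 mulr0.
Qed.

End StationaryEnergy.

(** * Continuity of the inverse matrix *)

Section ContinuousMatrices.
Variables (R : realType) (E : normedModType (cplx R)).

Lemma continuous_prod (I : finType) (f : I -> E -> cplx R) x :
  (forall i, {for x, continuous (f i)}) -> {for x, continuous (fun y => \prod_i f i y)}.
Proof.
move=> H; elim: (index_enum I) => [|i s IH].
  have -> : (fun y => \prod_(j <- [::]) f j y) = (fun=> 1 : cplx R).
    by apply/funext => y; rewrite big_nil.
  exact: cvg_cst.
have -> : (fun y => \prod_(j <- i :: s) f j y) = (fun y => f i y * \prod_(j <- s) f j y).
  by apply/funext => y; rewrite big_cons.
exact: (cvgM (H i) IH).
Qed.

Lemma continuous_det m (A : E -> 'M[cplx R]_m) x :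
  (forall i j, {for x, continuous (fun y => A y i j)}) -> {for x, continuous (fun y => \det (A y))}.
Proof.
move=> H; apply: continuous_sum => s.
have h := @continuous_prod _ (fun i y => A y i (s i)) x (fun i => H i (s i)).
by apply: cvgM; [exact: cvg_cst | exact: h].
Qed.

Lemma continuous_invmx m (A : E -> 'M[cplx R]_m) (U : set E) x i j :
  open U -> U x -> (forall y, U y -> A y \in unitmx) ->
  (forall i j, {for x, continuous (fun y => A y i j)}) ->
  {for x, continuous (fun y => invmx (A y) i j)}.
Proof.
move=> oU Ux uA H.
pose f y := (\det (A y))^-1 * ((-1) ^+ (j + i) * \det (row' j (col' i (A y)))).
have fE y : U y -> f y = invmx (A y) i j.
  by move=> Uy; rewrite /invmx uA// !mxE.
have hd : {for x, continuous (fun y => (\det (A y))^-1)}.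
  by apply: cvgV; [have := uA x Ux; rewrite unitmxE unitfE | exact: continuous_det].
have hm : {for x, continuous (fun y => \det (row' j (col' i (A y))))}.
  apply: continuous_det => k l.
  have -> : (fun y => row' j (col' i (A y)) k l) = (fun y => A y (lift j k) (lift i l)).
    by apply/funext => y; rewrite !mxE.
  exact: H.
have hf : f y @[y --> x] --> f x.
  by apply: cvgM; [exact: hd | apply: cvgM; [exact: cvg_cst | exact: hm]].
rewrite (fE x Ux) in hf; apply: cvg_trans hf; apply: near_eq_cvg.
by apply: filterS (open_near oU Ux) => y /fE.
Qed.

End ContinuousMatrices.

Lemma near0_ex (R : realType) (P : R -> Prop) :
  (\forall t \near (0 : R), P t) -> exists2 d : R, 0 < d & forall t, `|t| < d -> P t.
Proof.
move=> /nbhs_normP[d d0 H]; exists d => // t td; apply: H.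
by rewrite /ball_ /= sub0r normrN.
Qed.

Lemma re_real_cplxM (R : realType) (x : R) (w : cplx R) : re (real_cplx x * w) = x * re w.
Proof. by rewrite reM /= mul0r subr0. Qed.

Lemma is_derive_ratio0 (R : realType) (g h : R -> R) (K d : R) :
  h 0 != 0 -> g 0 = K * h 0 -> is_derive (0 : R) 1 h d -> is_derive (0 : R) 1 g (K * d) ->
  is_derive (0 : R) 1 (fun t => g t / h t) 0.
Proof.
move=> h0 gh Dh Dg; apply: (is_derive_eq (is_derive_mul Dg (is_deriveV h0 Dh))).
rewrite gh /GRing.scale /=; move: (h 0) h0 => x x0; by field.
Qed.

(** * Vanishing of delta_j L on the whole slit *)

Section HorizontalEnergy.
Variables (R : realType) (n : nat).
Local Notation V := 'rV[cplx R]_n.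
Variables (a : V -> 'M[cplx R]_n) (b : V -> V) (U : set V).
Hypothesis U_open : open U.
Hypothesis a_smooth : forall i j, csmooth_on U (fun z => a z i j).
Hypothesis b_smooth : forall i, csmooth_on U (fun z => b z 0 i).
Hypothesis a_herm : forall z, U z -> forall i j, a z i j = (a z j i)^*.
Hypothesis a_pos : forall z, U z -> pos_def (a z).
Variable excl : bool.
Variable F : V -> V -> R.
Variable phi : R -> R -> R.
Local Notation S := (chart_slit b U excl).
Hypothesis F_phi : forall y, S y ->
  F y.1 y.2 = phi (alpha a y.1 y.2) (abs_beta b y.1 y.2).
Hypothesis energy_smooth : smooth_on S (energy F).
Hypothesis ab_prop : forall z eta, U z -> beta b z eta != 0 ->
  beta_alpha_proportional a b z eta.
Hypothesis ab_rank : forall z, U z -> b z != 0 -> rank_one a b z.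
Implicit Types z eta v w e : V.
Implicit Types y W : V * V.

Local Notation Lc := (fun y => real_cplx (energy F y)).
Local Notation A2 := (alpha2 a).
Local Notation B2 := (beta2 b).
Local Notation hd j z eta := (hdir a j z eta).

Lemma hdir_alpha2_flat j z eta : U z ->
  is_derive (0 : R) 1 (fun t => A2 (real_line (z, eta) (hd j z eta) t)) 0 /\
  is_derive (0 : R) 1 (fun t => A2 (real_line (z, eta) (iunit R *: hd j z eta) t)) 0.
Proof. exact: (hdir_alpha2 U_open a_smooth a_pos). Qed.

Lemma hdir_beta2_flat j z eta : U z ->
  is_derive (0 : R) 1 (fun t => B2 (real_line (z, eta) (hd j z eta) t)) 0 /\
  is_derive (0 : R) 1 (fun t => B2 (real_line (z, eta) (iunit R *: hd j z eta) t)) 0.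
Proof.
move=> Uz; apply: (hdir_beta2 b_smooth a_herm a_pos) => //; last exact: ab_rank.
by apply: (polarize U_open a_smooth b_smooth a_pos) => // x; exact: ab_prop.
Qed.

Lemma horizontal_generic j z eta : S (z, eta) -> b z != 0 ->
  beta b z eta != 0 -> b_perp a b z eta != 0 -> chol (hd j z eta) Lc (z, eta) = 0.
Proof.
move=> Sy bz be pe; have [[Uz _] _] := Sy.
have [A1 A2'] := hdir_alpha2_flat j eta Uz.
have [B1 B2'] := hdir_beta2_flat j eta Uz.
apply: chol_energy0.
  exact: (stationary_generic U_open b_smooth a_herm a_pos F_phi energy_smooth Sy bz be pe A1 B1).
exact: (stationary_generic U_open b_smooth a_herm a_pos F_phi energy_smooth Sy bz be pe A2' B2').
Qed.

Lemma horizontal_b0 j z eta : S (z, eta) -> (\forall z' \near z, b z' = 0) ->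
  chol (hd j z eta) Lc (z, eta) = 0.
Proof.
move=> Sy nb; have [[Uz _] _] := Sy.
have [A1 A2'] := hdir_alpha2_flat j eta Uz.
(* The ratio of |beta|^2 to alpha^2 is constantly 0 here, a case of [stationary_proportional]. *)
have H W : \forall t \near (0 : R), B2 (real_line (z, eta) W t) = 0 * A2 (real_line (z, eta) W t).
  apply: filterS (near_real_line W.1 nb) => t bt; rewrite mul0r.
  apply: real_cplx_inj; rewrite beta2E.
  suff -> : beta b (real_line z W.1 t) (real_line (z, eta) W t).2 = 0 by rewrite mul0r.
  by apply: big1 => i _; rewrite bt mxE mul0r.
apply: chol_energy0.
  exact: (stationary_proportional U_open b_smooth a_pos F_phi energy_smooth Sy A1 (H _)).
exact: (stationary_proportional U_open b_smooth a_pos F_phi energy_smooth Sy A2' (H _)).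
Qed.

(** The hypothesis on |beta|^2 is an identity of (1,0) derivatives. As [norm_b2] and both functions
    are real, it splits into one proportionality along each of the two real directions. *)
Lemma proportional_derive j z eta : U z -> beta b z eta != 0 ->
  exists d1 d2 : R,
  [/\ is_derive (0 : R) 1 (fun t => A2 (real_line (z, eta) (delta_mx 0 j, 0) t)) d1,
      is_derive (0 : R) 1 (fun t => B2 (real_line (z, eta) (delta_mx 0 j, 0) t))
        (re (norm_b2 a b z) * d1),
      is_derive (0 : R) 1 (fun t => A2 (real_line (z, eta) (iunit R *: delta_mx 0 j, 0) t)) d2 &
      is_derive (0 : R) 1 (fun t => B2 (real_line (z, eta) (iunit R *: delta_mx 0 j, 0) t))
        (re (norm_b2 a b z) * d2)].
Proof.
move=> Uz be0.
have bz : b z != 0.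
  by apply: contraNneq be0 => b0; apply/eqP/big1 => i _; rewrite b0 mxE mul0r.
have [nbE _] := gt0_cplx (norm_b2_gt0 (a_herm Uz) (a_pos Uz) bz).
have [p [q h]] : exists p q,
    wirt (delta_mx 0 j, 0) (fun y : V * V => hform (a y.1) y.2 y.2) (z, eta) p q.
  by eexists; exact: (wirt_alpha2 a_smooth eta (delta_mx 0 j) 0 Uz).
have [qE [/wirt_val[h1 _] D1 D2]] := wirt_real (alpha2_near U_open a_pos eta Uz) h.
have [p' [q' g]] : exists p' q',
    wirt (delta_mx 0 j, 0) (fun y : V * V => real_cplx (abs_beta b y.1 y.2 ^+ 2)) (z, eta) p' q'.
  by do 2 eexists; exact: (wirt_beta2 b_smooth eta (delta_mx 0 j) 0 Uz).
have nr : \forall y \near (z, eta), real_cplx (abs_beta b y.1 y.2 ^+ 2) =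
   real_cplx ((fun y : V * V => abs_beta b y.1 y.2 ^+ 2) y) by exact: filterE.
have [q'E [/wirt_val[g1 _] D1' D2']] := wirt_real nr g.
have pp : p' = norm_b2 a b z * p.
  rewrite -h1 -g1; have := ab_prop Uz be0 j.
  rewrite /dhol -!/(chol _ _ _).
  by rewrite (@chol_fst R V V (fun y => real_cplx (abs_beta b y.1 y.2 ^+ 2)) (delta_mx 0 j) z eta)
     (@chol_fst R V V (fun y => real_cplx (alpha a y.1 y.2 ^+ 2)) (delta_mx 0 j) z eta).
rewrite scale_fst in D2; rewrite scale_fst in D2'.
exists (re (p + q)), (re (iunit R * (p - q))).
have e1 : re (p' + q') = re (norm_b2 a b z) * re (p + q).
  rewrite q'E pp qE nbE rmorphM /= conj_real_cplx -mulrDr.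
  exact: re_real_cplxM.
have e2 : re (iunit R * (p' - q')) = re (norm_b2 a b z) * re (iunit R * (p - q)).
  rewrite q'E pp qE nbE rmorphM /= conj_real_cplx -mulrBr mulrCA.
  exact: re_real_cplxM.
by rewrite -e1 -e2; split.
Qed.

Lemma dim1_form0 z v : (forall i k : 'I_n, i = k) -> b z != 0 -> lform (b z) v = 0 -> v = 0.
Proof.
move=> one bz; have [i bi] : exists i, b z 0 i != 0.
  apply: contrapT => H; move/eqP: bz; apply; apply/rowP => k; rewrite mxE.
  by apply/eqP/negPn/negP => h; apply: H; exists k.
rewrite /lform (bigD1 i)//= big1 ?addr0 => [/eqP|k /negP[]]; last exact/eqP/one.
rewrite mulf_eq0 (negbTE bi) /= => /eqP vi; apply/rowP => k.
by rewrite (one k i) vi mxE.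
Qed.

(** The equality case of Cauchy-Schwarz: in dimension one [b_perp] is annihilated by the nonzero
    form [b], hence is 0. *)
Lemma dim1_proportional z v : (forall i k : 'I_n, i = k) -> U z -> b z != 0 ->
  B2 (z, v) = re (norm_b2 a b z) * A2 (z, v).
Proof.
move=> one Uz bz.
have [nbE K0] := gt0_cplx (norm_b2_gt0 (a_herm Uz) (a_pos Uz) bz).
have nbn : norm_b2 a b z != 0 by rewrite gt_eqF// norm_b2_gt0//; [exact: a_herm | exact: a_pos].
have bp : lform (b z) (b_perp a b z v) = 0.
  rewrite /b_perp -scaleNr lformD lformZ lform_b_up mulNr divfK//.
  exact: subrr.
have /eqP := dim1_form0 one bz bp; rewrite subr_eq0 => /eqP vE.
have hv : hform (a z) v v = beta b z v / norm_b2 a b z * (beta b z v)^*.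
  by rewrite {1}vE hformZl (hform_b_upl b (a_herm Uz) (a_pos Uz)).
apply: real_cplx_inj; rewrite real_cplxM beta2E -nbE (alpha2_hform a_pos)// hv.
by rewrite mulrA [_ * (_ / _)]mulrC divfK.
Qed.

Local Opaque alpha2 beta2.

Lemma energy_csmooth : csmooth_on S Lc.
Proof. exact: (smooth_real_cplx (@chart_slit_open R n b U U_open b_smooth excl) energy_smooth). Qed.

Lemma slit_open : open S.
Proof. exact: (@chart_slit_open R n b U U_open b_smooth excl). Qed.

(* [||b||^2] is the value of [B2 / A2] at any fixed [eta], and this ratio has
   zero derivative in [z]. *)
Lemma dim1_near_proportional z eta (W : V * V) : U z -> eta != 0 ->
  (forall i k : 'I_n, i = k) -> b z != 0 ->
  (forall z, U z -> beta b z eta != 0 -> exists d : R,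
    is_derive (0 : R) 1 (fun t => A2 (real_line (z, eta) (W.1, 0) t)) d /\
    is_derive (0 : R) 1 (fun t => B2 (real_line (z, eta) (W.1, 0) t))
        (re (norm_b2 a b z) * d)) ->
  \forall t \near (0 : R), B2 (real_line (z, eta) W t) =
     re (norm_b2 a b z) * A2 (real_line (z, eta) W t).
Proof.
move=> Uz e0 one bz HD.
have be z' : b z' != 0 -> beta b z' eta != 0.
  by move=> bz'; apply: contraNneq e0 => h; apply/eqP/(dim1_form0 one bz' h).
have nU : \forall z' \near z, U z' := open_near U_open Uz.
have nb0 : \forall z' \near z, b z' != 0.
  have [k bk] : exists k, b z 0 k != 0.
    apply: contrapT => H; move/eqP: bz; apply; apply/rowP => k; rewrite mxE.
    by apply/eqP/negPn/negP => h; apply: H; exists k.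
  have nk : \forall z' \near z, b z' 0 k != 0.
    by apply: (cvgr_neq0 _ (csmooth_continuous (b_smooth k) Uz) bk).
  by apply: filterS nk => z' h; apply: contraNneq h => ->; rewrite mxE.
have [d d0 Hd] := near0_ex (near_real_line W.1 (filterI nU nb0)).
pose f (y : V * V) : R := B2 y / A2 y.
have prop t v : `|t| < d -> B2 (real_line z W.1 t, v) =
    re (norm_b2 a b (real_line z W.1 t)) * A2 (real_line z W.1 t, v).
  by move=> /Hd [Ut bt]; exact: (dim1_proportional v one Ut bt).
have Df t : `|t| < d -> is_derive (0 : R) 1
    (fun s => f (real_line (real_line (z, eta) (W.1, 0) t) (W.1, 0) s)) 0.
  move=> td; have [Ut bt] := Hd t td.
  rewrite (real_line_fst z eta); have [dA [DA DB]] := HD _ Ut (be _ bt).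
  set zt := real_line z W.1 t in Ut bt DA DB *.
  have A0 : A2 (real_line (zt, eta) (W.1, 0) 0) != 0.
    by rewrite real_line0 gt_eqF// (alpha2_gt0 a_pos).
  by apply: (is_derive_ratio0 A0 _ DA DB); rewrite real_line0; exact: prop.
have cst t : `|t| < d -> f (real_line z W.1 t, eta) = f (z, eta).
  move=> td; have [r rt|c ct] := @line_MVT R _ (W.1, 0) f (z, eta) t.
    exact: (proj1 (rder_val (Df r (le_lt_trans rt td)))).
  rewrite (proj2 (rder_val (Df c (le_lt_trans ct td)))) mul0r real_line_fst.
  by move=> /eqP; rewrite subr_eq0 => /eqP.
(* Read at the fixed [eta], the moving factor [norm_b2] is the function [f] just shown constant, so
   it may be replaced by its value at [z]. *)
have K t : `|t| < d -> re (norm_b2 a b (real_line z W.1 t)) = f (real_line z W.1 t, eta).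
  move=> td; have [Ut bt] := Hd t td.
  by rewrite /f (prop t eta td) mulfK// gt_eqF// (alpha2_gt0 a_pos).
apply: filterS (near0_norm_lt d0) => t td.
apply: etrans (prop t (real_line (z, eta) W t).2 td) _.
rewrite (K t td) (cst t td) -[z in f (z, _)](real_line0 z W.1).
by rewrite -K ?normr0// real_line0.
Qed.

Lemma horizontal_dim1 j z eta : S (z, eta) -> (forall i k : 'I_n, i = k) -> b z != 0 ->
  chol (hd j z eta) Lc (z, eta) = 0.
Proof.
move=> Sy one bz; have [[Uz _] e0] := Sy; rewrite /= in Uz e0.
have [A1 A2'] := hdir_alpha2_flat j eta Uz.
have PD z' (Uz' : U z') (h : beta b z' eta != 0) :=
  proportional_derive j Uz' h.
apply: chol_energy0.
  apply: (stationary_proportional U_open b_smooth a_pos F_phi energy_smooth Sy A1).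
  apply: dim1_near_proportional => // z' Uz' h; have [d1 [d2 [? ? ? ?]]] := PD z' Uz' h.
  by exists d1.
apply: (stationary_proportional U_open b_smooth a_pos F_phi energy_smooth Sy A2').
apply: dim1_near_proportional => // z' Uz' h; have [d1 [d2 [? ? ? ?]]] := PD z' Uz' h.
by exists d2.
Qed.

Lemma hdirE j z eta : hd j z eta =
  (delta_mx 0 j, 0) + \sum_k (- Na a k j z eta) *: (0 : V, delta_mx 0 k : V).
Proof.
have E (c : 'I_n -> cplx R) : \sum_k c k *: (0 : V, delta_mx 0 k : V) =
    (0, \sum_k c k *: delta_mx 0 k).
  elim: (index_enum _) => [|k s IH]; first by rewrite !big_nil.
  by rewrite !big_cons IH scale_snd; congr pair; rewrite /= addr0.
rewrite E /hdir; congr pair; rewrite /= ?addr0// add0r.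
by rewrite [LHS]row_sum_delta; apply: eq_bigr => k _; rewrite !mxE.
Qed.

(** Constant directions with variable coefficients: in this form the horizontal derivative is
    continuous in [y], although [hdir] itself changes with the point. *)
Lemma horizontalE j y : S y -> chol (hd j y.1 y.2) Lc y =
  chol (delta_mx 0 j, 0) Lc y - \sum_k Na a k j y.1 y.2 * chol (0, delta_mx 0 k) Lc y.
Proof.
move=> Sy; rewrite hdirE (chol_dirD _ _ slit_open energy_csmooth Sy).
rewrite (chol_dir_sum _ _ slit_open energy_csmooth Sy) -sumrN; congr (_ + _).
by apply: eq_bigr => k _; rewrite mulNr.
Qed.

Lemma continuous_Na k j y : U y.1 -> {for y, continuous (fun y => Na a k j y.1 y.2)}.
Proof.
move=> Uy; apply: continuous_sum => m; apply: continuous_sum => l.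
apply: cvgM; first apply: cvgM.
- apply: (@continuous_fst_comp R n (fun z => invmx (a z) m k)).
  apply: (@continuous_invmx R _ n a U y.1 m k U_open Uy) => [z Uz|i i'].
    exact: (pos_def_unit (a_pos Uz)).
  exact: (csmooth_continuous (a_smooth i i') Uy).
- apply: (@continuous_fst_comp R n (dhol j (fun w => a w l m))).
  exact: (csmooth_continuous (csmooth_chol (delta_mx 0 j) U_open (a_smooth l m)) Uy).
- by apply: (@continuous_snd_comp R n (fun z => z 0 l)); exact: continuous_coord.
Qed.

Lemma continuous_horizontal j y : S y ->
  {for y, continuous (fun y => chol (delta_mx 0 j, 0) Lc y
     - \sum_k Na a k j y.1 y.2 * chol (0, delta_mx 0 k) Lc y)}.
Proof.
move=> Sy; have [[Uy _] _] := Sy.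
have C u : {for y, continuous (chol u Lc)}.
  exact: (csmooth_continuous (csmooth_chol u slit_open energy_csmooth) Sy).
apply: cvgB; first exact: C.
apply: continuous_sum => k; apply: cvgM; last exact: C.
exact: continuous_Na.
Qed.

Lemma near_horizontal_neq0 j y : S y -> chol (hd j y.1 y.2) Lc y != 0 ->
  \forall y' \near y, S y' /\ chol (hd j y'.1 y'.2) Lc y' != 0.
Proof.
move=> Sy; rewrite (horizontalE j Sy) => h.
have nh : \forall y' \near y, chol (delta_mx 0 j, 0) Lc y'
     - \sum_k Na a k j y'.1 y'.2 * chol (0, delta_mx 0 k) Lc y' != 0.
  by apply: (cvgr_neq0 _ (continuous_horizontal Sy) h).
have nS : \forall y' \near y, S y' := open_near slit_open Sy.
by apply: filterS2 nS nh => y' Sy' h'; split=> //; rewrite horizontalE.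
Qed.

(** If beta vanishes at [eta], move along [b_up_vec]: beta becomes nonzero and [b_perp] is still
    [eta]. If [b_perp] vanishes, move along a kernel vector of [b]: beta is kept and [b_perp]
    becomes a multiple of that vector. *)
Lemma exists_generic_direction z eta : U z -> b z != 0 -> eta != 0 ->
  (exists2 v, v != 0 & lform (b z) v = 0) ->
  exists v, forall t : R, t != 0 ->
    beta b z (eta + real_cplx t *: v) != 0 /\ b_perp a b z (eta + real_cplx t *: v) != 0
  \/ beta b z eta != 0 /\ b_perp a b z eta != 0.
Proof.
move=> Uz bz e0 [v v0 bv].
have nbn := norm_b2_neq0 (a_herm Uz) (a_pos Uz) bz.
have bD v1 v2 : beta b z (v1 + v2) = beta b z v1 + beta b z v2 := lformD (b z) v1 v2.
have tn (t : R) : t != 0 -> real_cplx t != 0 :> cplx R.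
  by apply: contraNneq => /real_cplx_inj ->.
have [be|be] := eqVneq (beta b z eta) 0.
  exists (b_up_vec a b z) => t t0; left.
  have bbu : beta b z (b_up_vec a b z) = norm_b2 a b z := lform_b_up a b z.
  have E : beta b z (eta + real_cplx t *: b_up_vec a b z) = real_cplx t * norm_b2 a b z.
    by rewrite bD be add0r beta_scale bbu.
  rewrite E mulf_neq0 ?tn//; split=> //.
  by rewrite /b_perp E mulfK// addrK.
(* If [eta] is already generic, any witness will do. *)
have [pe|pe] := eqVneq (b_perp a b z eta) 0; last by exists 0 => t t0; right.
exists v => t t0; left.
have E : beta b z (eta + real_cplx t *: v) = beta b z eta.
  by rewrite bD beta_scale [beta b z v]bv mulr0 addr0.
rewrite E; split=> //.
have -> : b_perp a b z (eta + real_cplx t *: v) = b_perp a b z eta + real_cplx t *: v.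
  by rewrite /b_perp E addrAC.
by rewrite pe add0r scaler_eq0 negb_or tn.
Qed.

Lemma horizontal_b_neq0 j z eta : S (z, eta) -> b z != 0 ->
  chol (hd j z eta) Lc (z, eta) = 0.
Proof.
move=> Sy bz; have [[Uz _] e0] := Sy; rewrite /= in Uz e0.
have [one|] := pselect (forall i k : 'I_n, i = k); first exact: horizontal_dim1.
move=> /existsNP[i /existsNP[k /eqP ik]].
have ker : exists2 v, v != 0 & lform (b z) v = 0.
  have [bi|bi] := eqVneq (b z 0 i) 0.
    exists (delta_mx 0 i); last by rewrite /lform linear_form_delta.
    by apply/eqP => /rowP/(_ i); rewrite !mxE !eqxx => /eqP; rewrite oner_eq0.
  (* Two distinct indices give a kernel vector of [b]; its [k]-th entry - b_i is nonzero in this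
     case. *)
  exists (b z 0 k *: delta_mx 0 i - b z 0 i *: delta_mx 0 k).
    apply/eqP => /rowP/(_ k); rewrite !mxE !eqxx (eq_sym k) (negbTE ik) /= mulr0 mulr1 add0r.
    by move/eqP; rewrite oppr_eq0 (negbTE bi).
  by rewrite -scaleNr lformD !lformZ /lform !linear_form_delta mulNr mulrC subrr.
have [v Hv] := exists_generic_direction Uz bz e0 ker.
apply/eqP/negPn/negP => h.
have nh := near_horizontal_neq0 (y := (z, eta)) Sy h.
have [d d0 Hd] := near0_ex (near_real_line (0, v) nh).
(* Any nonzero parameter below [d] would serve: the derivative is still nonzero there, yet the
   vector is generic. *)
have d2 : d / 2 != 0 by rewrite mulf_neq0 ?invr_eq0 ?pnatr_eq0// gt_eqF.
have dd : `|d / 2| < d by rewrite gtr0_norm ?divr_gt0// ltr_pdivrMr// mulr_natr mulr2n ltrDl.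
have := Hd _ dd; rewrite real_line_snd /= => -[Sy' /eqP]; apply.
have [[be pe]|[be pe]] := Hv _ d2; first exact: horizontal_generic.
by move/eqP: h; case; exact: horizontal_generic.
Qed.

Lemma horizontal0 j z eta : S (z, eta) -> chol (hd j z eta) Lc (z, eta) = 0.
Proof.
move=> Sy; have [bz|] := eqVneq (b z) 0; last exact: horizontal_b_neq0.
(* A nonzero value would persist near (z, eta). Since the derivative is 0 wherever b <> 0, this
   forces [b] to vanish around [z], and then [horizontal_b0] contradicts it. *)
apply/eqP/negPn/negP => h; move/eqP: (h); apply.
apply: horizontal_b0 => //.
have nh := near_horizontal_neq0 (y := (z, eta)) Sy h.
have [[A B] /= [zA eB] AB] := nh.
apply: filterS zA => z' Az'; have [Sy' h'] := AB (z', eta) (conj Az' (@nbhs_singleton V eta B eB)).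
by apply/eqP/negPn/negP => bz'; move/eqP: h'; apply; exact: horizontal_b_neq0.
Qed.

End HorizontalEnergy.

(** * The Chern-Finsler connection *)

(** Only germs matter, with no differentiability asked of [f] or [g]; so it applies to [N] and [G]
    directly. *)
Lemma chol_near (R : realType) (E : normedModType (cplx R)) (f g : E -> cplx R) u x :
  (\forall y \near x, f y = g y) -> chol u f x = chol u g x.
Proof.
move=> fg.
have H v : cder v f x = cder v g x.
  by congr Complex; apply: rder_near; apply: filterS fg => y /= ->.
by rewrite /chol !H.
Qed.

Section ChernConnection.
Variables (R : realType) (n : nat).
Local Notation V := 'rV[cplx R]_n.
Variable a : V -> 'M[cplx R]_n.
Implicit Types (z eta : V) (i j k : 'I_n).

Definition chern i j k z : cplx R := \sum_m invmx (a z) m i * dhol k (fun w => a w j m) z.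

Lemma wirt_Na i j k z eta :
  wirt (delta_mx 0 j) (Na a i k z) eta (chern i j k z) 0.
Proof.
have h : wirt (delta_mx 0 j) (Na a i k z) eta
    (\sum_m \sum_l invmx (a z) m i * dhol k (fun w => a w l m) z * (delta_mx 0 j : V) 0 l)
    (\sum_(m < n) \sum_(l < n) invmx (a z) m i * dhol k (fun w => a w l m) z * 0).
  by apply: wirt_sum => m; apply: wirt_sum => l; apply: wirtZ; exact: wirt_coord.
apply: wirt_eq h.
  apply: eq_bigr => m _; rewrite (bigD1 j)//= [X in _ + X]big1 ?addr0.
    by rewrite mxE !eqxx mulr1.
  by move=> l lj; rewrite mxE (negbTE lj) andbF mulr0.
by apply: big1 => m _; apply: big1 => l _; rewrite mulr0.
Qed.

(** The (0,1) part 0 is what counts: [Na] is holomorphic along the fibres, so a derivative in conj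
    [eta] passes through it. *)
Lemma wirt_Na_joint k j m z eta : wirt (0 : V, delta_mx 0 m : V)
  (fun y : V * V => Na a k j y.1 y.2) (z, eta) (chern k m j z) 0.
Proof.
have [h1 h2] := wirt_Na k m j z eta; split.
  split; [move: h1 => [h1 _] | move: h1 => [_ h1]];
    by under [X in is_derive _ _ X]eq_fun do rewrite real_line_snd.
rewrite scale_snd.
split; [move: h2 => [h2 _] | move: h2 => [_ h2]];
  by under [X in is_derive _ _ X]eq_fun do rewrite real_line_snd.
Qed.

Lemma dhol_Na i j k z eta : dhol j (Na a i k z) eta = chern i j k z.
Proof. by have [] := wirt_val (wirt_Na i j k z eta). Qed.

Lemma dhol_Ga i j z eta : dhol j (Ga a i z) eta =
  2^-1 * \sum_l (chern i j l z * eta 0 l + Na a i l z eta * (delta_mx 0 j : V) 0 l).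
Proof.
have h : wirt (delta_mx 0 j) (Ga a i z) eta
   (2^-1 * \sum_l (chern i j l z * eta 0 l + Na a i l z eta * (delta_mx 0 j : V) 0 l))
   (2^-1 * \sum_(l < n) (0 * eta 0 l + Na a i l z eta * 0)).
  apply: wirtZ; apply: wirt_sum => l.
  exact: (wirtM (wirt_Na i j l z eta) (wirt_coord (delta_mx 0 j) eta l)).
exact: (proj1 (wirt_val h)).
Qed.

(** [Ga] is a quadratic polynomial in [eta], so [eta] is absent from the right-hand side. *)
Lemma dhol2_Ga i j k z eta : dhol k (dhol j (Ga a i z)) eta =
  2^-1 * \sum_l (chern i j l z * (delta_mx 0 k : V) 0 l + (delta_mx 0 j : V) 0 l * chern i k l z).
Proof.
have -> : dhol j (Ga a i z) = (fun eta =>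
    2^-1 * \sum_l (chern i j l z * eta 0 l + (delta_mx 0 j : V) 0 l * Na a i l z eta)).
  apply/funext => eta'; rewrite dhol_Ga; congr (_ * _); apply: eq_bigr => l _.
  by congr (_ + _); exact: mulrC.
have h : wirt (delta_mx 0 k) (fun eta : V =>
    2^-1 * \sum_l (chern i j l z * eta 0 l + (delta_mx 0 j : V) 0 l * Na a i l z eta)) eta
  (2^-1 * \sum_l (chern i j l z * (delta_mx 0 k : V) 0 l + (delta_mx 0 j : V) 0 l * chern i k l z))
  (2^-1 * \sum_l (chern i j l z * 0 + (delta_mx 0 j : V) 0 l * 0)).
  apply: wirtZ; apply: wirt_sum => l; apply: wirtD; apply: wirtZ.
    exact: wirt_coord.
  exact: wirt_Na.
exact: (proj1 (wirt_val h)).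
Qed.

End ChernConnection.

(** * Identification of the Chern-Finsler connection with the Chern connection of [a] *)

Section FinslerConnection.
Variables (R : realType) (n : nat).
Local Notation V := 'rV[cplx R]_n.
Variables (a : V -> 'M[cplx R]_n) (S : set (V * V)) (F : V -> V -> R).
Hypothesis S_open : open S.
Hypothesis energy_smooth : smooth_on S (energy F).
Hypothesis F_homog : forall z eta (c : cplx R), S (z, eta) -> S (z, c *: eta) ->
  F z (c *: eta) = re `|c| * F z eta.
Hypothesis g_pos : forall z eta, S (z, eta) -> pos_def (g F z eta).
Hypothesis horizontal : forall j z eta, S (z, eta) ->
  chol (delta_mx 0 j, 0) (fun y => real_cplx (energy F y)) (z, eta) =
  \sum_k Na a k j z eta * chol (0, delta_mx 0 k) (fun y => real_cplx (energy F y)) (z, eta).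
Implicit Types (z eta : V) (i j k l m : 'I_n) (y : V * V).

Local Notation Lc := (fun y => real_cplx (energy F y)).
Local Notation ez j := (delta_mx 0 j : V, 0 : V).
Local Notation ev m := (0 : V, delta_mx 0 m : V).

Lemma lagrangian_csmooth : csmooth_on S Lc.
Proof. exact: (smooth_real_cplx S_open energy_smooth). Qed.

Lemma fundamental_tensorE z eta l m : g F z eta l m = chol (ev l) (cbar (ev m) Lc) (z, eta).
Proof.
rewrite mxE.
have -> : dbar m (Lag F z) = (fun eta => cbar (ev m) Lc (z, eta)).
  apply/funext => eta'.
  exact: (@cbar_snd R V V Lc (delta_mx 0 m) z eta').
exact: (@chol_snd R V V (cbar (ev m) Lc) (delta_mx 0 l) z eta).
Qed.

Lemma energy_scale z eta (c : cplx R) : S (z, eta) -> S (z, c *: eta) ->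
  energy F (z, c *: eta) = re `|c| ^+ 2 * energy F (z, eta).
Proof. by move=> S1 S2; rewrite /energy /= F_homog// exprMn. Qed.

Lemma re_norm2 (c : cplx R) : re `|c| ^+ 2 = re c ^+ 2 + im c ^+ 2.
Proof.
have h : real_cplx (re `|c|) = `|c|.
  have := normr_ge0 c; rewrite le_eqVlt => /orP[/eqP <-//|/gt0_cplx[<-]//].
have := normCK c; rewrite -h expr2 -real_cplxM => /(congr1 (@re R)).
by rewrite reM re_conj im_conj mulrN opprK /= -!expr2.
Qed.

(** Homogeneity under complex scalars: the energy is multiplied by (1 + t)^2 along [eta] and by 1 +
    t^2 along [i eta]. The derivatives are 2 L and 0, so the (1,0) derivative is L. *)
Lemma energy_euler z eta : S (z, eta) ->
  \sum_l eta 0 l * chol (ev l) Lc (z, eta) = Lc (z, eta).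
Proof.
move=> Sy.
have E : (0, eta) = \sum_l eta 0 l *: (0 : V, delta_mx 0 l : V).
  have E' (c : 'I_n -> cplx R) : \sum_k c k *: (0 : V, delta_mx 0 k : V) =
      (0, \sum_k c k *: delta_mx 0 k).
    elim: (index_enum _) => [|k s IH]; first by rewrite !big_nil.
    by rewrite !big_cons IH scale_snd; congr pair; rewrite /= addr0.
  by rewrite E' -row_sum_delta.
rewrite -(chol_dir_sum _ _ S_open lagrangian_csmooth Sy) -E.
have near c (f : R -> cplx R) : (forall t, real_line eta (c *: eta) t = f t *: eta) ->
    \forall t \near (0 : R), (re (f t) ^+ 2 + im (f t) ^+ 2) * energy F (z, eta) =
      energy F (real_line (z, eta) (0, c *: eta) t).
  move=> cf; apply: filterS (near_real_line (0, c *: eta) (open_near S_open Sy)) => t St.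
  rewrite real_line_snd cf in St *.
  by rewrite energy_scale// re_norm2.
have D1 : is_derive (0 : R) 1 (fun t => energy F (real_line (z, eta) (0, eta) t))
    (2 * energy F (z, eta)).
  have := @near 1 (fun t => 1 + real_cplx t); rewrite scale1r => h.
  apply: near_eq_is_derive (h _) _.
    by move=> t; rewrite /real_line scalerDl scale1r.
  under [X in is_derive _ _ X]eq_fun do rewrite reD imD /= addr0 expr0n /= addr0.
  have D : is_derive (0 : R) 1 (fun t : R => (1 + t) * (1 + t) * energy F (z, eta)) (2 * energy F (z, eta)).
    have d1 : is_derive (0 : R) 1 (fun t : R => 1 + t) 1.
      rewrite -[X in is_derive _ _ _ X]add0r; apply: is_deriveD.
    apply: (is_derive_eq (is_derive_mul (is_derive_mul d1 d1)
      (is_derive_cst (energy F (z, eta)) (0 : R) (1 : R)))).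
    by rewrite /cst; move: (energy F (z, eta)) => e; ring.
  by under [X in is_derive _ _ X]eq_fun do rewrite expr2.
have D2 : is_derive (0 : R) 1 (fun t => energy F (real_line (z, eta) (0, iunit R *: eta) t)) 0.
  have h := @near (iunit R) (fun t => 1 + real_cplx t * iunit R).
  apply: near_eq_is_derive (h _) _.
    by move=> t; rewrite /real_line scalerDl scale1r scalerA.
  under [X in is_derive _ _ X]eq_fun do rewrite reD imD reM imM /= !mulr0 mul0r subr0 mulr1 !addr0 add0r expr1n expr2.
  have d1 : is_derive (0 : R) 1 (fun t : R => 1 + t * t) 0.
    rewrite -[X in is_derive _ _ _ X]add0r; apply: is_deriveD.
    apply: (is_derive_eq (is_derive_mul (is_derive_id (0 : R) (1 : R)) (is_derive_id (0 : R) (1 : R)))).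
    by rewrite mulr0 mul0r addr0.
  apply: (is_derive_eq (is_derive_mul d1 (is_derive_cst (energy F (z, eta)) (0 : R) (1 : R)))).
  by rewrite mul0r mulr0 addr0.
have c1 := has_cder_val (has_cder_real D1).
have c2 := has_cder_val (has_cder_real D2).
rewrite /chol scale_snd c1 c2 real_cplx0 mulr0 subr0.
have -> : real_cplx (2 * energy F (z, eta)) = 2 * real_cplx (energy F (z, eta)).
  have r2 : real_cplx 2 = 2 :> cplx R by rewrite [in LHS]mulr2n real_cplxD real_cplx1 -mulr2n.
  by rewrite real_cplxM r2.
by rewrite mulrA mulVf ?mul1r// two_neq0.
Qed.

Lemma near_pair_S z eta : S (z, eta) -> \forall y \near (z, eta), S y.
Proof. exact: open_near. Qed.

(** Euler's identity differentiated in conj eta^m, where eta^l behaves as a constant: [g] contracted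
    with [eta] is dL/d(conj eta^m). *)
Lemma cbar_euler m z eta : S (z, eta) ->
  \sum_l eta 0 l * chol (ev l) (cbar (ev m) Lc) (z, eta) = cbar (ev m) Lc (z, eta).
Proof.
move=> Sy.
have h : wirt (ev m) (fun y => \sum_l y.2 0 l * chol (ev l) Lc y) (z, eta)
   (\sum_l ((delta_mx 0 m : V) 0 l * chol (ev l) Lc (z, eta) + eta 0 l * chol (ev m) (chol (ev l) Lc) (z, eta)))
   (\sum_l (0 * chol (ev l) Lc (z, eta) + eta 0 l * cbar (ev m) (chol (ev l) Lc) (z, eta))).
  apply: wirt_sum => l.
  have h1 := wirt_snd (0 : V) z (wirt_coord (delta_mx 0 m) eta l).
  exact: (wirtM h1 (csmooth_wirt (ev m) (csmooth_chol (ev l) S_open lagrangian_csmooth) Sy)).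
have nh : \forall y \near (z, eta), \sum_l (y : V * V).2 0 l * chol (ev l) Lc y = Lc y.
  by apply: filterS (near_pair_S Sy) => -[z' eta'] /energy_euler.
have [_ ->] := wirt_val (wirt_near nh h).
apply: eq_bigr => l _; rewrite mul0r add0r; congr (_ * _).
exact: (chol_cbarC (ev l) (ev m) S_open lagrangian_csmooth Sy).
Qed.

(** By [cbar_euler] the left-hand side is the derivative of L in z^j and conj eta^m. Exchange the
    two, replace dL/dz^j by [Na] applied to the fibre derivatives of L, and differentiate in conj
    eta^m, which does not act on [Na]. *)
Lemma dhol_fundamental_tensor j m z eta : S (z, eta) ->
  \sum_l dhol j (fun w => g F w eta l m) z * eta 0 l = \sum_k Na a k j z eta * g F z eta k m.
Proof.
move=> Sy.
have sm : csmooth_on S (cbar (ev m) Lc) := csmooth_cbar (ev m) S_open lagrangian_csmooth.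
transitivity (chol (ez j) (cbar (ev m) Lc) (z, eta)).
  have h : wirt (ez j) (fun y => \sum_l y.2 0 l * chol (ev l) (cbar (ev m) Lc) y) (z, eta)
   (\sum_l ((0 : V) 0 l * chol (ev l) (cbar (ev m) Lc) (z, eta) +
     eta 0 l * chol (ez j) (chol (ev l) (cbar (ev m) Lc)) (z, eta)))
   (\sum_l (0 * chol (ev l) (cbar (ev m) Lc) (z, eta) +
     eta 0 l * cbar (ez j) (chol (ev l) (cbar (ev m) Lc)) (z, eta))).
    apply: wirt_sum => l.
    have h1 := wirt_snd (delta_mx 0 j : V) z (wirt_coord 0 eta l).
    exact: (wirtM h1 (csmooth_wirt (ez j) (csmooth_chol (ev l) S_open sm) Sy)).
  have nh : \forall y \near (z, eta), \sum_l (y : V * V).2 0 l * chol (ev l) (cbar (ev m) Lc) y = cbar (ev m) Lc y.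
    by apply: filterS (near_pair_S Sy) => -[z' eta'] /cbar_euler.
  have [-> _] := wirt_val (wirt_near nh h).
  apply: eq_bigr => l _; rewrite [X in _ = X * _ + _]mxE mul0r add0r mulrC; congr (_ * _).
  have -> : (fun w => g F w eta l m) = (fun w => chol (ev l) (cbar (ev m) Lc) (w, eta)).
    by apply/funext => w; rewrite fundamental_tensorE.
  exact: (@chol_fst R V V (chol (ev l) (cbar (ev m) Lc)) (delta_mx 0 j) z eta).
rewrite (chol_cbarC (ez j) (ev m) S_open lagrangian_csmooth Sy).
have h : wirt (ev m) (fun y => \sum_k Na a k j y.1 y.2 * chol (ev k) Lc y) (z, eta)
   (\sum_k (chern a k m j z * chol (ev k) Lc (z, eta) + Na a k j z eta * chol (ev m) (chol (ev k) Lc) (z, eta)))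
   (\sum_k (0 * chol (ev k) Lc (z, eta) + Na a k j z eta * cbar (ev m) (chol (ev k) Lc) (z, eta))).
  apply: wirt_sum => k.
  exact: (wirtM (wirt_Na_joint a k j m z eta) (csmooth_wirt (ev m) (csmooth_chol (ev k) S_open lagrangian_csmooth) Sy)).
have nh : \forall y \near (z, eta), \sum_k Na a k j (y : V * V).1 y.2 * chol (ev k) Lc y = chol (ez j) Lc y.
  by apply: filterS (near_pair_S Sy) => -[z' eta'] /(horizontal j) ->.
have [_ ->] := wirt_val (wirt_near nh h).
apply: eq_bigr => k _; rewrite mul0r add0r fundamental_tensorE; congr (_ * _).
exact: esym (chol_cbarC (ev k) (ev m) S_open lagrangian_csmooth Sy).
Qed.

Lemma finsler_N i j z eta : S (z, eta) -> N F i j z eta = Na a i j z eta.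
Proof.
move=> Sy; have /matrixP E := mulmxV (pos_def_unit (g_pos Sy)).
transitivity (\sum_k Na a k j z eta * \sum_m g F z eta k m * invmx (g F z eta) m i).
  transitivity (\sum_m \sum_k invmx (g F z eta) m i * (Na a k j z eta * g F z eta k m)).
    apply: eq_bigr => m _; rewrite -[RHS]mulr_sumr -(dhol_fundamental_tensor j m Sy) [RHS]mulr_sumr.
    by apply: eq_bigr => l _; rewrite [RHS]mulrA.
  rewrite exchange_big; apply: eq_bigr => k _; rewrite [RHS]mulr_sumr; apply: eq_bigr => m _.
  by rewrite [LHS]mulrC [RHS]mulrA.
rewrite (bigD1 i)//= [X in _ + X]big1 ?addr0.
  by have := E i i; rewrite !mxE eqxx => ->; rewrite mulr1.
by move=> k ki; have := E k i; rewrite !mxE (negbTE ki) => ->; rewrite mulr0.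
Qed.

Lemma near_snd_S z eta : S (z, eta) -> \forall eta' \near eta, S (z, eta').
Proof.
move=> Sy; have [[A B] /= [zA eB] AB] := near_pair_S Sy.
by apply: filterS eB => eta' Be; apply: (AB (z, eta') (conj (@nbhs_singleton V z A zA) Be)).
Qed.

Lemma finsler_CF i j k z eta : S (z, eta) -> CF F i j k z eta = chern a i j k z.
Proof.
move=> Sy; rewrite -(dhol_Na a i j k z eta).
by apply: chol_near; apply: filterS (near_snd_S Sy) => eta'; exact: finsler_N.
Qed.

Lemma finsler_G i z eta : S (z, eta) -> G F i z eta = Ga a i z eta.
Proof.
move=> Sy; apply: (congr1 (fun s => 2^-1 * s)); apply: eq_bigr => j _.
exact: (congr1 (fun s => s * eta 0 j) (finsler_N i j Sy)).
Qed.

Lemma finsler_BL i j k z eta : S (z, eta) -> BL F i j k z eta = dhol k (dhol j (Ga a i z)) eta.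
Proof.
move=> Sy; apply: chol_near; apply: filterS (near_snd_S Sy) => eta' Sy'.
by apply: chol_near; apply: filterS (near_snd_S Sy') => eta''; exact: finsler_G.
Qed.

End FinslerConnection.

(** * The four conditions on the manifold *)

Section VanishingForm.
Variables (R : realType) (n : nat).
Local Notation V := 'rV[cplx R]_n.
Variables (a : V -> 'M[cplx R]_n) (b : V -> V) (z : V).
Hypothesis bz : b z = 0.

Let beta0 eta : beta b z eta = 0.
Proof. by apply: big1 => i _; rewrite bz mxE mul0r. Qed.

Let nb0 : norm_b2 a b z = 0.
Proof. exact: norm_b2_eq0. Qed.

Lemma cond_i_b0 eta : cond_i a b z eta.
Proof. by move=> l; rewrite beta0 nb0 conjC0 !mul0r. Qed.

Lemma cond_ii_b0 eta : cond_ii a b z eta.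
Proof. by move=> l; rewrite beta0 nb0 conjC0 !mul0r. Qed.

Lemma cond_iii_b0 eta : cond_iii b z eta.
Proof. by move=> s i; rewrite beta0 /bbar_low bz mxE conjC0 !mul0r. Qed.

Lemma cond_iv_b0 eta : cond_iv a b z eta.
Proof. by rewrite /cond_iv beta0 conjC0 !mul0r addr0. Qed.

End VanishingForm.

Lemma chart_img_open (R : realType) (n : nat) (M : complex_manifold R n) (c : chart_index M) :
  open (chart_img c).
Proof. by case: M c => T I dom ch chi h1 h2 h3 h4 h5 h6 h7 h8 h9 c; exact: h5. Qed.

(** * From one chart to the manifold *)

Section AlphaBetaSpace.
Variables (R : realType) (n : nat) (M : complex_manifold R n).
Variables (a : metric_coef M) (b : form_coef M) (F : tangent_fun M) (excl : bool).
Hypothesis ha : hermitian_metric a.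
Hypothesis hb : form10 b.
Hypothesis hF : complex_finsler (fdom excl b) F.
Hypothesis hFab : of_alpha_beta (fdom excl b) a b F.
Hypothesis hprop : on_slit (fdom excl b) (fun c => beta_alpha_proportional (a c) (b c)).

Let a_smooth c i j : csmooth_on (chart_img c) (fun z => a c z i j).
Proof. by case: ha. Qed.

Let a_herm c z (Uz : chart_img c z) i j : a c z i j = (a c z j i)^*.
Proof. by case: ha => _ h _ _; exact: h. Qed.

Let a_pos c z (Uz : chart_img c z) : pos_def (a c z).
Proof. by case: ha => _ _ h _; exact: h. Qed.

Let b_smooth c i : csmooth_on (chart_img c) (fun z => b c z 0 i).
Proof. by case: hb. Qed.

(** Such vectors belong to the slit for either value of [excl], and the polarizations use no others;
    hence the two cases are treated together. *)
Lemma slit_beta_neq0 c z eta : chart_img c z -> beta (b c) z eta != 0 ->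
  slit (fdom excl b) c (z, eta).
Proof.
move=> Uz h; split=> //=; apply: contraNneq h => ->.
by apply/eqP/big1 => i _; rewrite mxE mulr0.
Qed.

Let ab_prop c z eta : chart_img c z -> beta (b c) z eta != 0 ->
  beta_alpha_proportional (a c) (b c) z eta.
Proof. by move=> Uz h; apply: hprop; exact: slit_beta_neq0. Qed.

Let polar c z (Uz : chart_img c z) := polarize (@chart_img_open R n M c) (@a_smooth c)
  (@b_smooth c) (@a_pos c) Uz (fun eta => @ab_prop c z eta Uz).

(** The common form through which the four conditions are compared. At the zeros of [b] both sides
    of each condition vanish, so only points with b <> 0 carry information. *)
Definition all_rank_one := forall c z, chart_img c z -> b c z != 0 -> rank_one (a c) (b c) z.

Lemma cond_ii_rank_one :
  on_slit (fdom excl b) (fun c => cond_ii (a c) (b c)) <-> all_rank_one.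
Proof.
split=> H c z => [Uz bz|eta Sy].
  apply: (ii_rank_one bz) => eta h; apply: H; exact: slit_beta_neq0.
have [[Uz _] _] := Sy; have [bz|bz] := eqVneq (b c z) 0; first exact: cond_ii_b0.
exact: (rank_one_ii eta (H c z Uz bz)).
Qed.

Lemma cond_i_rank_one :
  on_slit (fdom excl b) (fun c => cond_i (a c) (b c)) <-> all_rank_one.
Proof.
split=> H c z => [Uz bz|eta Sy].
  apply: (ii_rank_one bz) => eta h.
  apply/(cond_i_ii (a_herm Uz) (a_pos Uz) (polar Uz) eta bz).
  by apply: H; exact: slit_beta_neq0.
have [[Uz _] _] := Sy; have [bz|bz] := eqVneq (b c z) 0; first exact: cond_i_b0.
apply/(cond_i_ii (a_herm Uz) (a_pos Uz) (polar Uz) eta bz).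
exact: (rank_one_ii eta (H c z Uz bz)).
Qed.

Lemma cond_iii_rank_one :
  on_slit (fdom excl b) (fun c => cond_iii (b c)) <-> all_rank_one.
Proof.
split=> H c z => [Uz bz|eta Sy].
  apply: (ii_rank_one bz) => eta h; apply: (iii_ii (a_herm Uz)).
  by apply: H; exact: slit_beta_neq0.
have [[Uz _] _] := Sy; have [bz|bz] := eqVneq (b c z) 0; first exact: cond_iii_b0.
exact: (rank_one_iii (a_herm Uz) (a_pos Uz) eta bz (H c z Uz bz)).
Qed.

Lemma cond_iv_rank_one :
  on_slit (fdom excl b) (fun c => cond_iv (a c) (b c)) <-> all_rank_one.
Proof.
split=> H c z => [Uz bz|eta Sy].
  apply: (iv_rank_one (a_herm Uz) (polar Uz) bz) => eta h.
  by apply: H; exact: slit_beta_neq0.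
have [[Uz _] _] := Sy; have [bz|bz] := eqVneq (b c z) 0; first exact: cond_iv_b0.
apply: (ii_iv (a_herm Uz) (a_pos Uz) (polar Uz) bz).
exact: (rank_one_ii eta (H c z Uz bz)).
Qed.

Section RankOne.
Hypothesis hr : all_rank_one.
Variable c : chart_index M.
Local Notation S := (chart_slit (b c) (chart_img c) excl).

Let S_open : open S.
Proof. exact: (@chart_slit_open R n (b c) (chart_img c) (@chart_img_open R n M c) (@b_smooth c) excl). Qed.

Let S_smooth : smooth_on S (energy (F c)).
Proof. exact: (@finsler_smooth R n M (fdom excl b) F hF c). Qed.

Let S_homog z eta (l : cplx R) : S (z, eta) -> S (z, l *: eta) ->
  F c z (l *: eta) = re `|l| * F c z eta.
Proof. by move=> [h1 _] [h2 _]; exact: (finsler_homog hF h1 h2). Qed.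

Let S_pos z eta : S (z, eta) -> pos_def (g (F c) z eta).
Proof. exact: (finsler_pos_def hF). Qed.

Let S_horizontal j z eta : S (z, eta) ->
  chol (delta_mx 0 j, 0) (fun y => real_cplx (energy (F c) y)) (z, eta) =
  \sum_k Na (a c) k j z eta * chol (0, delta_mx 0 k) (fun y => real_cplx (energy (F c) y)) (z, eta).
Proof.
move=> Sy; have [phi Fphi] := hFab.
have h := horizontalE (a c) (@chart_img_open R n M c) (@b_smooth c) S_smooth j Sy.
have h0 : chol (hdir (a c) j z eta) (fun y => real_cplx (energy (F c) y)) (z, eta) = 0.
  apply: (@horizontal0 R n (a c) (b c) (chart_img c) (@chart_img_open R n M c) (@a_smooth c)
    (@b_smooth c) (@a_herm c) (@a_pos c) excl (F c) phi _ S_smooth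
    (@ab_prop c) (@hr c) j z eta Sy).
  by move=> [z' eta'] [Dy _]; exact: Fphi.
by apply/eqP; rewrite -subr_eq0 -h; apply/eqP.
Qed.

Lemma chart_CF i j k z eta : S (z, eta) -> CF (F c) i j k z eta = chern (a c) i j k z.
Proof. exact: (finsler_CF S_open S_smooth S_homog S_pos S_horizontal). Qed.

Lemma chart_BL i j k z eta : S (z, eta) ->
  BL (F c) i j k z eta = dhol k (dhol j (Ga (a c) i z)) eta.
Proof. exact: (finsler_BL S_open S_smooth S_homog S_pos S_horizontal). Qed.

End RankOne.

Lemma rank_one_generalized_berwald : all_rank_one -> generalized_berwald (fdom excl b) F.
Proof.
move=> hr c i j k z eta eta' S1 S2.
by rewrite (chart_BL hr i j k S1) (chart_BL hr i j k S2) !dhol2_Ga.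
Qed.

Lemma rank_one_berwald : all_rank_one -> kahler_metric a -> complex_berwald (fdom excl b) F.
Proof.
move=> hr ka; split=> [c i k z eta Sy|c i j k z eta eta' S1 S2].
  apply: big1 => j _; rewrite (chart_CF hr i j k Sy) (chart_CF hr i k j Sy).
  have [[Uz _] _] := Sy.
  have -> : chern (a c) i j k z = chern (a c) i k j z.
    by apply: eq_bigr => m _; rewrite (ka c j m k z Uz).
  by rewrite subrr mul0r.
by rewrite (chart_CF hr i j k S1) (chart_CF hr i j k S2).
Qed.

End AlphaBetaSpace.

Theorem theorem4p1 (R : realType) (n : nat) (M : complex_manifold R n)
    (a : metric_coef M) (b : form_coef M) (F : tangent_fun M) (excl : bool)
    (ha : hermitian_metric a) (hb : form10 b)
    (hF : complex_finsler (fdom excl b) F)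
    (hFab : of_alpha_beta (fdom excl b) a b F)
    (hprop : on_slit (fdom excl b)
               (fun c => beta_alpha_proportional (a c) (b c))) :
  let Ci := on_slit (fdom excl b) (fun c => cond_i (a c) (b c)) in
  let Cii := on_slit (fdom excl b) (fun c => cond_ii (a c) (b c)) in
  let Ciii := on_slit (fdom excl b) (fun c => cond_iii (b c)) in
  let Civ := on_slit (fdom excl b) (fun c => cond_iv (a c) (b c)) in
  [/\ Ci <-> Cii, Cii <-> Ciii & Ciii <-> Civ] /\
  (Ci \/ Cii \/ Ciii \/ Civ ->
   generalized_berwald (fdom excl b) F /\
   (kahler_metric a -> complex_berwald (fdom excl b) F)).
Proof.
move=> Ci Cii Ciii Civ.
have e1 : Ci <-> all_rank_one a b := cond_i_rank_one ha hb hprop.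
have e2 : Cii <-> all_rank_one a b := cond_ii_rank_one a b excl.
have e3 : Ciii <-> all_rank_one a b := cond_iii_rank_one b excl ha.
have e4 : Civ <-> all_rank_one a b := cond_iv_rank_one ha hb hprop.
split; first by split; tauto.
have hr : Ci \/ Cii \/ Ciii \/ Civ -> all_rank_one a b by tauto.
move=> /hr h; split; first exact: (rank_one_generalized_berwald ha hb hF hFab hprop h).
exact: (rank_one_berwald ha hb hF hFab hprop h).
Qed.
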